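(* Let $\mathbf{C}$ be a category and let $\Sigma$ be an extended presentation of $\mathbf{C}$. The following assertions are equivalent: (i) the $(3,1)$-polygraph $\Sigma$ is a coherent presentation of $\mathbf{C}$; (ii) for every $2$-category $\mathcal{C}$, there is an equivalence of categories $$2\mathrm{Rep}(\mathbf{C},\mathcal{C})\ \approx\ 2\mathrm{Cat}(\overline{\Sigma},\mathcal{C})$$ that is natural in $\mathcal{C}$.
   Context: **Polygraphs and coherent presentations.** All $n$-categories are strict and globular; $f\star_i g$ is composition along $i$-cells in diagrammatic order. A $2$-polygraph consists of a set $\Sigma_0$ of $0$-cells, a set $\Sigma_1$ of generating $1$-cells with source and target in $\Sigma_0$ (generating the free category $\Sigma_1^*$), and a set $\Sigma_2$ of generating $2$-cells, each with source and target a pair of parallel $1$-cells of $\Sigma_1^*$. $\Sigma_2^\top$ denotes the free $(2,1)$-category it generates (all $2$-cells invertible for $\star_1$). The category presented is the quotient of $\Sigma_1^*$ by the congruence generated by $\Sigma_2$. A $(3,1)$-polygraph $\Sigma$ is a $2$-polygraph together with a set $\Sigma_3$ of generating $3$-cells, each with source and target a pair of parallel $2$-cells of $\Sigma_2^\top$; the category it presents is the one presented by its underlying $2$-polygraph, and the $(2,1)$-category it presents is $\overline{\Sigma}=\Sigma_2^\top/\Sigma_3$ (identify $s(\gamma)$ and $t(\gamma)$ for all $\gamma\in\Sigma_3$). $\Sigma$ is an extended presentation of $\mathbf{C}$ if the category it presents is isomorphic to $\mathbf{C}$. It is a coherent presentation of $\mathbf{C}$ if moreover $\Sigma_3$ is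 a homotopy basis, i.e. any two parallel $2$-cells of $\Sigma_2^\top$ become equal in $\overline{\Sigma}$. **$2$-representations.** A category is seen as a $2$-category with only identity $2$-cells. For $2$-categories $\mathcal{C},\mathcal{D}$, the category $2\mathrm{Rep}(\mathcal{C},\mathcal{D})$ has as objects the pseudofunctors $\mathcal{C}\to\mathcal{D}$ (with invertible coherence $2$-cells $F_{u,v}:F(u)F(v)\Rightarrow F(uv)$ and $F_x:1_{F(x)}\Rightarrow F(1_x)$) and as morphisms the pseudonatural transformations (with $1$-cell components $\alpha_x:F(x)\to G(x)$ and invertible $2$-cell components $\alpha_u:F(u)\alpha_y\Rightarrow\alpha_xG(u)$ for $u:x\to y$), with the usual composition. $2\mathrm{Cat}(\mathcal{C},\mathcal{D})$ is the full subcategory of $2\mathrm{Rep}(\mathcal{C},\mathcal{D})$ whose objects are the (strict) $2$-functors. Naturality in the target $2$-category is with respect to postcomposition with $2$-functors. *)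

(* Defs.v *)
From Corelib Require Import ssreflect.
From Stdlib Require Import FunctionalExtensionality PropExtensionality.
From Stdlib Require Import ProofIrrelevance ClassicalEpsilon.
From Stdlib Require Import RelationClasses.

Set Implicit Arguments.
Unset Strict Implicit.
Unset Printing Implicit Defensive.

Record Category := {
  ob :> Type;
  hom : ob -> ob -> Type;
  id1 : forall x, hom x x;
  comp : forall x y z, hom x y -> hom y z -> hom x z;
  compA : forall x y z t (f : hom x y) (g : hom y z) (h : hom z t),
    comp (comp f g) h = comp f (comp g h);
  comp1l : forall x y (f : hom x y), comp (id1 x) f = f;
  comp1r : forall x y (f : hom x y), comp f (id1 y) = f }.

Arguments hom {_} _ _.
Arguments id1 {_} _.
Arguments comp {_ _ _ _} _ _.

(** Composition is written in diagrammatic order throughout. *)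
Notation "f · g" := (comp f g) (at level 40, left associativity).

Record Functor (A B : Category) := {
  fob :> A -> B;
  fmap : forall x y, hom x y -> hom (fob x) (fob y);
  fmap_id : forall x, fmap (id1 x) = id1 (fob x);
  fmap_comp : forall x y z (f : hom x y) (g : hom y z),
    fmap (f · g) = fmap f · fmap g }.

Arguments fmap {_ _} _ {_ _} _.

Definition idF (A : Category) : Functor A A.
Proof. by refine {| fob := fun x => x; fmap := fun x y f => f |}. Defined.

Definition compF (A B C : Category) (F : Functor A B) (G : Functor B C) :
  Functor A C.
Proof.
refine {| fob := fun x => G (F x); fmap := fun x y f => fmap G (fmap F f) |}.
- by move=> x; rewrite !fmap_id.
- by move=> x y z f g; rewrite !fmap_comp.
Defined.

Definition isomorphic (A B : Category) : Prop :=
  exists (F : Functor A B) (G : Functor B A),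
    compF F G = idF A /\ compF G F = idF B.

Definition is_iso (A : Category) (x y : A) (f : hom x y) : Prop :=
  exists g : hom y x, f · g = id1 x /\ g · f = id1 y.

Definition nat_isomorphic (A B : Category) (F G : Functor A B) : Prop :=
  exists eta : forall x, hom (F x) (G x),
    (forall x, is_iso (eta x)) /\
    (forall x y (f : hom x y), fmap F f · eta y = eta x · fmap G f).

Definition is_equivalence (A B : Category) (F : Functor A B) : Prop :=
  exists G : Functor B A,
    nat_isomorphic (compF F G) (idF A) /\ nat_isomorphic (compF G F) (idF B).

Definition full_subcategory (A : Category) (P : A -> Prop) : Category :=
  {| ob := {x : A | P x};
     hom := fun x y => hom (proj1_sig x) (proj1_sig y);
     id1 := fun x => id1 (proj1_sig x);
     comp := fun x y z f g => f · g;
     compA := fun x y z t => @compA A _ _ _ _;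
     comp1l := fun x y => @comp1l A _ _;
     comp1r := fun x y => @comp1r A _ _ |}.

(** [cell x y] collects all 2-cells between 1-cells from [x] to [y], with
    boundary maps [src] and [tgt]; [vcomp] is the partial composition along
    1-cells and [hcomp] the composition along 0-cells.  This way strict
    associativity of [hcomp] is an ordinary equality. *)
Record TwoCat := {
  cat1 :> Category;
  cell : cat1 -> cat1 -> Type;
  src : forall x y, cell x y -> hom x y;
  tgt : forall x y, cell x y -> hom x y;
  id2 : forall x y, hom x y -> cell x y;
  vcomp : forall x y (a b : cell x y), tgt a = src b -> cell x y;
  hcomp : forall x y z, cell x y -> cell y z -> cell x z;
  src_id2 : forall x y (u : hom x y), src (id2 u) = u;
  tgt_id2 : forall x y (u : hom x y), tgt (id2 u) = u;
  src_vcomp : forall x y (a b : cell x y) e, src (@vcomp x y a b e) = src a;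
  tgt_vcomp : forall x y (a b : cell x y) e, tgt (@vcomp x y a b e) = tgt b;
  src_hcomp : forall x y z (a : cell x y) (b : cell y z),
    src (hcomp a b) = src a · src b;
  tgt_hcomp : forall x y z (a : cell x y) (b : cell y z),
    tgt (hcomp a b) = tgt a · tgt b;
  vcompA : forall x y (a b c : cell x y) e1 e2 e3 e4,
    @vcomp x y (@vcomp x y a b e1) c e2 = @vcomp x y a (@vcomp x y b c e3) e4;
  vcomp1l : forall x y (a : cell x y) e, @vcomp x y (id2 (src a)) a e = a;
  vcomp1r : forall x y (a : cell x y) e, @vcomp x y a (id2 (tgt a)) e = a;
  hcompA : forall x y z t (a : cell x y) (b : cell y z) (c : cell z t),
    hcomp (hcomp a b) c = hcomp a (hcomp b c);
  hcomp1l : forall x y (a : cell x y), hcomp (id2 (id1 x)) a = a;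
  hcomp1r : forall x y (a : cell x y), hcomp a (id2 (id1 y)) = a;
  hcomp_id2 : forall x y z (u : hom x y) (v : hom y z),
    hcomp (id2 u) (id2 v) = id2 (u · v);
  interchange : forall x y z (a b : cell x y) (c d : cell y z) e1 e2 e3,
    hcomp (@vcomp x y a b e1) (@vcomp y z c d e2)
    = @vcomp x z (hcomp a c) (hcomp b d) e3 }.

Arguments cell {_} _ _.
Arguments src {_ _ _} _.
Arguments tgt {_ _ _} _.
Arguments id2 {_ _ _} _.
Arguments vcomp {_ _ _} _ _ _.
Arguments hcomp {_ _ _ _} _ _.

(** [vcomp] as a total operation, with a junk value on pairs that are not
    composable; every use below is on composable pairs. *)
Definition vc (A : TwoCat) (x y : A) (a b : cell x y) : cell x y :=
  match excluded_middle_informative (tgt a = src b) with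
  | left e => vcomp a b e
  | right _ => a
  end.

Notation "a ⋆₀ b" := (hcomp a b) (at level 40, left associativity).
Notation "a ⋆₁ b" := (vc a b) (at level 45, left associativity).

Lemma vcE (A : TwoCat) (x y : A) (a b : cell x y) (e : tgt a = src b) :
  a ⋆₁ b = vcomp a b e.
Proof.
rewrite /vc; case: (excluded_middle_informative _) => // e'.
by rewrite (proof_irrelevance _ e e').
Qed.

Lemma src_vc (A : TwoCat) (x y : A) (a b : cell x y) :
  tgt a = src b -> src (a ⋆₁ b) = src a.
Proof. by move=> e; rewrite (vcE e) src_vcomp. Qed.

Lemma tgt_vc (A : TwoCat) (x y : A) (a b : cell x y) :
  tgt a = src b -> tgt (a ⋆₁ b) = tgt b.
Proof. by move=> e; rewrite (vcE e) tgt_vcomp. Qed.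

Lemma vcA (A : TwoCat) (x y : A) (a b c : cell x y) :
  tgt a = src b -> tgt b = src c -> a ⋆₁ b ⋆₁ c = a ⋆₁ (b ⋆₁ c).
Proof.
move=> e e'; rewrite (vcE e) (vcE e').
have e2 : tgt (vcomp a b e) = src c by rewrite tgt_vcomp.
have e4 : tgt a = src (vcomp b c e') by rewrite src_vcomp.
by rewrite (vcE e2) (vcE e4); apply: vcompA.
Qed.

Lemma vc1l (A : TwoCat) (x y : A) (u : hom x y) (a : cell x y) :
  u = src a -> id2 u ⋆₁ a = a.
Proof.
move=> ->; have e : tgt (id2 (src a)) = src a by rewrite tgt_id2.
by rewrite (vcE e) vcomp1l.
Qed.

Lemma vc1r (A : TwoCat) (x y : A) (u : hom x y) (a : cell x y) :
  tgt a = u -> a ⋆₁ id2 u = a.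
Proof.
move=> <-; have e : tgt a = src (id2 (tgt a)) by rewrite src_id2.
by rewrite (vcE e) vcomp1r.
Qed.

Lemma vc_hcomp (A : TwoCat) (x y z : A) (a b : cell x y) (c d : cell y z) :
  tgt a = src b -> tgt c = src d ->
  (a ⋆₁ b) ⋆₀ (c ⋆₁ d) = a ⋆₀ c ⋆₁ b ⋆₀ d.
Proof.
move=> e e'; rewrite (vcE e) (vcE e').
have e3 : tgt (a ⋆₀ c) = src (b ⋆₀ d) by rewrite tgt_hcomp src_hcomp e e'.
by rewrite (vcE e3); apply: interchange.
Qed.

Definition invertible (A : TwoCat) (x y : A) (a : cell x y) : Prop :=
  exists b : cell x y,
    src b = tgt a /\ tgt b = src a /\
    a ⋆₁ b = id2 (src a) /\ b ⋆₁ a = id2 (tgt a).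

Lemma invertible_id2 (A : TwoCat) (x y : A) (u : hom x y) :
  invertible (id2 u).
Proof.
exists (id2 u); rewrite !src_id2 !tgt_id2; do 2!split=> //.
by rewrite vc1l // src_id2.
Qed.

Lemma invertible_vc (A : TwoCat) (x y : A) (a b : cell x y) :
  tgt a = src b -> invertible a -> invertible b -> invertible (a ⋆₁ b).
Proof.
move=> e [a' [sa [ta [aa' a'a]]]] [b' [sb [tb [bb' b'b]]]].
have e' : tgt b' = src a' by congruence.
exists (b' ⋆₁ a').
rewrite !src_vc // !tgt_vc //; do 3!(split=> //).
- rewrite vcA // ?src_vc // -(vcA (a := b)) // bb' vc1l ?sa //.
- rewrite vcA // ?src_vc // -(vcA (a := a')) // a'a vc1l //.
Qed.

Lemma invertible_hcomp (A : TwoCat) (x y z : A) (a : cell x y) (b : cell y z) :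
  invertible a -> invertible b -> invertible (a ⋆₀ b).
Proof.
move=> [a' [sa [ta [aa' a'a]]]] [b' [sb [tb [bb' b'b]]]].
exists (a' ⋆₀ b'); rewrite !src_hcomp !tgt_hcomp -!vc_hcomp //.
by rewrite aa' a'a bb' b'b !hcomp_id2 sa sb ta tb.
Qed.

(** A category seen as a 2-category with only identity 2-cells: the 2-cells
    are the 1-cells themselves, each being its own source and target. *)
Definition locally_discrete (C : Category) : TwoCat.
Proof.
by refine {| cat1 := C; cell := fun x y => @hom C x y;
             src := fun x y u => u; tgt := fun x y u => u;
             id2 := fun x y u => u; vcomp := fun x y u v e => u;
             hcomp := fun x y z u v => u · v;
             hcompA := @compA C; hcomp1l := @comp1l C;
             hcomp1r := @comp1r C |}.
Defined.

Record PsFunctor (A B : TwoCat) := {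
  F0 :> A -> B;
  F1 : forall x y, hom x y -> hom (F0 x) (F0 y);
  F2 : forall x y : A, cell x y -> cell (F0 x) (F0 y);
  Fc : forall x y z : A, hom x y -> hom y z -> cell (F0 x) (F0 z);
  Fu : forall x, cell (F0 x) (F0 x);
  src_F2 : forall x y (a : cell x y), src (F2 a) = F1 (src a);
  tgt_F2 : forall x y (a : cell x y), tgt (F2 a) = F1 (tgt a);
  src_Fc : forall x y z (u : hom x y) (v : hom y z),
    src (Fc u v) = F1 u · F1 v;
  tgt_Fc : forall x y z (u : hom x y) (v : hom y z), tgt (Fc u v) = F1 (u · v);
  src_Fu : forall x, src (Fu x) = id1 (F0 x);
  tgt_Fu : forall x, tgt (Fu x) = F1 (id1 x);
  F2_id2 : forall x y (u : hom x y), F2 (id2 u) = id2 (F1 u);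
  F2_vc : forall x y (a b : cell x y),
    tgt a = src b -> F2 (a ⋆₁ b) = F2 a ⋆₁ F2 b;
  inv_Fc : forall x y z (u : hom x y) (v : hom y z), invertible (Fc u v);
  inv_Fu : forall x, invertible (Fu x);
  nat_Fc : forall x y z (a : cell x y) (b : cell y z),
    F2 a ⋆₀ F2 b ⋆₁ Fc (tgt a) (tgt b) = Fc (src a) (src b) ⋆₁ F2 (a ⋆₀ b);
  FcA : forall x y z t (u : hom x y) (v : hom y z) (w : hom z t),
    Fc u v ⋆₀ id2 (F1 w) ⋆₁ Fc (u · v) w
    = id2 (F1 u) ⋆₀ Fc v w ⋆₁ Fc u (v · w);
  Fc1l : forall x y (u : hom x y),
    Fu x ⋆₀ id2 (F1 u) ⋆₁ Fc (id1 x) u = id2 (F1 u);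
  Fc1r : forall x y (u : hom x y),
    id2 (F1 u) ⋆₀ Fu y ⋆₁ Fc u (id1 y) = id2 (F1 u) }.

Arguments F1 {_ _} _ {_ _} _.
Arguments F2 {_ _} _ {_ _} _.
Arguments Fc {_ _} _ {_ _ _} _ _.
Arguments Fu {_ _} _ _.

Record PsNat (A B : TwoCat) (F G : PsFunctor A B) := {
  N1 : forall x, hom (F x) (G x);
  N2 : forall x y : A, hom x y -> cell (F x) (G y);
  src_N2 : forall x y (u : hom x y), src (N2 u) = F1 F u · N1 y;
  tgt_N2 : forall x y (u : hom x y), tgt (N2 u) = N1 x · F1 G u;
  inv_N2 : forall x y (u : hom x y), invertible (N2 u);
  nat_N2 : forall x y (a : cell x y),
    F2 F a ⋆₀ id2 (N1 y) ⋆₁ N2 (tgt a) = N2 (src a) ⋆₁ id2 (N1 x) ⋆₀ F2 G a;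
  N2_comp : forall x y z (u : hom x y) (v : hom y z),
    Fc F u v ⋆₀ id2 (N1 z) ⋆₁ N2 (u · v)
    = id2 (F1 F u) ⋆₀ N2 v ⋆₁ N2 u ⋆₀ id2 (F1 G v) ⋆₁ id2 (N1 x) ⋆₀ Fc G u v;
  N2_id : forall x,
    Fu F x ⋆₀ id2 (N1 x) ⋆₁ N2 (id1 x) = id2 (N1 x) ⋆₀ Fu G x }.

Arguments N1 {_ _ _ _} _ _.
Arguments N2 {_ _ _ _} _ {_ _} _.

Lemma psnat_ext (A B : TwoCat) (F G : PsFunctor A B) (al be : PsNat F G) :
  (forall x, N1 al x = N1 be x) ->
  (forall x y (u : hom x y), N2 al u = N2 be u) -> al = be.
Proof.
case: al be => [n1 n2 p1 p2 p3 p4 p5 p6] [m1 m2 q1 q2 q3 q4 q5 q6] /= e1 e2.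
have {}e1 : n1 = m1 by apply: functional_extensionality_dep.
have {}e2 : n2 = m2.
  do 3!(apply: functional_extensionality_dep => ?); exact: e2.
subst m1 m2; f_equal; exact: proof_irrelevance.
Qed.

Ltac bd_step :=
  first [ rewrite src_hcomp | rewrite tgt_hcomp
        | rewrite src_id2 | rewrite tgt_id2
        | rewrite src_F2 | rewrite tgt_F2 | rewrite src_Fc | rewrite tgt_Fc
        | rewrite src_Fu | rewrite tgt_Fu | rewrite src_N2 | rewrite tgt_N2
        | rewrite comp1l | rewrite comp1r | rewrite compA
        | rewrite src_vc; [solve [bd] |] | rewrite tgt_vc; [solve [bd] |] ]
with bd := intros; repeat bd_step; try reflexivity; try congruence.

Definition psnat_id (A B : TwoCat) (F : PsFunctor A B) : PsNat F F.
Proof.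
refine {| N1 := fun x => id1 (F x); N2 := fun x y u => id2 (F1 F u) |}.
- by bd.
- by bd.
- by move=> *; apply: invertible_id2.
- by move=> x y a; rewrite hcomp1l hcomp1r vc1l ?vc1r; bd.
- move=> x y z u v; rewrite hcomp1l hcomp1r hcomp_id2.
  by rewrite !vc1r ?vc1l; bd.
- by move=> x; rewrite hcomp1l hcomp1r vc1r; bd.
Defined.


Lemma whisk_l (A : TwoCat) (x y z : A) (f : hom x y) (a b : cell y z) :
  tgt a = src b -> id2 f ⋆₀ (a ⋆₁ b) = id2 f ⋆₀ a ⋆₁ id2 f ⋆₀ b.
Proof. by move=> e; rewrite -vc_hcomp // ?vc1l //; bd. Qed.

Lemma whisk_r (A : TwoCat) (x y z : A) (a b : cell x y) (f : hom y z) :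
  tgt a = src b -> (a ⋆₁ b) ⋆₀ id2 f = a ⋆₀ id2 f ⋆₁ b ⋆₀ id2 f.
Proof. by move=> e; rewrite -vc_hcomp // ?vc1l //; bd. Qed.

Lemma exchange (A : TwoCat) (x y z : A) (a : cell x y) (b : cell y z) :
  id2 (src a) ⋆₀ b ⋆₁ a ⋆₀ id2 (tgt b)
  = a ⋆₀ id2 (src b) ⋆₁ id2 (tgt a) ⋆₀ b.
Proof. by rewrite -!vc_hcomp ?vc1l ?vc1r //; bd. Qed.

Definition psnat_comp (A B : TwoCat) (F G H : PsFunctor A B)
  (al : PsNat F G) (be : PsNat G H) : PsNat F H.
Proof.
refine {| N1 := fun x => N1 al x · N1 be x;
          N2 := fun x y u =>
            N2 al u ⋆₀ id2 (N1 be y) ⋆₁ id2 (N1 al x) ⋆₀ N2 be u |}.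
- by bd.
- by bd.
- move=> x y u; apply: invertible_vc; first by bd.
    by apply: invertible_hcomp (inv_N2 _ _) (invertible_id2 _).
  by apply: invertible_hcomp (invertible_id2 _) (inv_N2 _ _).
- move=> x y a.
  rewrite -hcomp_id2 -(hcompA (F2 F a)) -vcA; [bd|bd|].
  rewrite -whisk_r; first by bd.
  rewrite nat_N2 whisk_r; first by bd.
  rewrite vcA; [bd|bd|].
  rewrite hcompA -whisk_l; first by bd.
  rewrite nat_N2 whisk_l; first by bd.
  by rewrite -vcA -?hcomp_id2 ?hcompA //; bd.
- move=> x y z u v.
  rewrite -(hcomp_id2 (N1 al z)) -(hcompA (Fc F u v)) -vcA; [bd|bd|].
  rewrite -whisk_r; first by bd.
  rewrite N2_comp !whisk_r; try by bd.
  rewrite !hcompA vcA; [bd|bd|].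
  rewrite -whisk_l; first by bd.
  rewrite N2_comp -(hcomp_id2 (N1 al x)) !whisk_l; try by bd.
  have := exchange (N2 al u) (N2 be v).
  rewrite src_N2 tgt_N2 src_N2 tgt_N2 -!hcomp_id2 !hcompA => E.
  rewrite !vcA; try by bd.
  congr (_ ⋆₁ _); rewrite -!vcA; by bd.
- move=> x.
  rewrite -!hcomp_id2 -hcompA -vcA; [bd|bd|].
  rewrite -whisk_r; first by bd.
  rewrite N2_id !hcompA -whisk_l; first by bd.
  by rewrite N2_id.
Defined.

Lemma psnat_compA (A B : TwoCat) (F G H K : PsFunctor A B)
  (al : PsNat F G) (be : PsNat G H) (ga : PsNat H K) :
  psnat_comp (psnat_comp al be) ga = psnat_comp al (psnat_comp be ga).
Proof.
apply: psnat_ext => [x | x y u] /=; first exact: compA.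
rewrite whisk_l ?whisk_r; try by bd.
by rewrite -!hcomp_id2 !hcompA vcA; bd.
Qed.

Lemma psnat_comp1l (A B : TwoCat) (F G : PsFunctor A B) (al : PsNat F G) :
  psnat_comp (psnat_id F) al = al.
Proof.
apply: psnat_ext => [x | x y u] /=; first exact: comp1l.
by rewrite hcomp1l hcomp_id2 vc1l; bd.
Qed.

Lemma psnat_comp1r (A B : TwoCat) (F G : PsFunctor A B) (al : PsNat F G) :
  psnat_comp al (psnat_id G) = al.
Proof.
apply: psnat_ext => [x | x y u] /=; first exact: comp1r.
by rewrite hcomp1r hcomp_id2 vc1r; bd.
Qed.

Definition TwoRep (A B : TwoCat) : Category :=
  {| ob := PsFunctor A B; hom := @PsNat A B;
     id1 := @psnat_id A B; comp := @psnat_comp A B;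
     compA := @psnat_compA A B;
     comp1l := @psnat_comp1l A B; comp1r := @psnat_comp1r A B |}.

(** A strict 2-functor is a pseudofunctor whose coherence 2-cells are
    identities; by [tgt_Fc] and [tgt_Fu] this forces
    [F1 u · F1 v = F1 (u · v)] and [id1 (F x) = F1 (id1 x)]. *)
Definition strict (A B : TwoCat) (F : PsFunctor A B) : Prop :=
  (forall (x y z : A) (u : hom x y) (v : hom y z),
      Fc F u v = id2 (F1 F u · F1 F v)) /\
  (forall x, Fu F x = id2 (id1 (F x))).

Definition TwoFunctor (A B : TwoCat) := {F : PsFunctor A B | strict F}.

(** The category of strict 2-functors and pseudonatural (not strictly
    2-natural) transformations. *)
Definition TwoCatFun (A B : TwoCat) : Category :=
  full_subcategory (A := TwoRep A B) (@strict A B).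

Lemma strict_comp (A B : TwoCat) (K : PsFunctor A B) (sK : strict K)
  (x y z : A) (u : hom x y) (v : hom y z) : F1 K (u · v) = F1 K u · F1 K v.
Proof. by rewrite -tgt_Fc (proj1 sK) tgt_id2. Qed.

Lemma strict_id (A B : TwoCat) (K : PsFunctor A B) (sK : strict K) (x : A) :
  F1 K (id1 x) = id1 (K x).
Proof. by rewrite -tgt_Fu (proj2 sK) tgt_id2. Qed.

Lemma strict_hcomp (A B : TwoCat) (K : PsFunctor A B) (sK : strict K)
  (x y z : A) (a : cell x y) (b : cell y z) :
  F2 K (a ⋆₀ b) = F2 K a ⋆₀ F2 K b.
Proof.
have := nat_Fc K a b; rewrite !(proj1 sK) vc1r; first by bd.
by rewrite vc1l // src_F2 src_hcomp strict_comp.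
Qed.

Lemma F2_invertible (A B : TwoCat) (K : PsFunctor A B) (x y : A)
  (a : cell x y) : invertible a -> invertible (F2 K a).
Proof.
move=> [b [sb [tb [ab ba]]]]; exists (F2 K b).
rewrite !src_F2 !tgt_F2 sb tb -!F2_vc // ab ba !F2_id2; by do !split.
Qed.

(** The coherence 2-cells of the composite are
    [Fc K _ _ ⋆₁ F2 K (Fc F u v)] and [Fu K _ ⋆₁ F2 K (Fu F x)]; since [K] is
    strict, the first factors are identities and are left out, and similarly
    for the components of [psnat_post]. *)
Definition ps_post (A B D : TwoCat) (F : PsFunctor A B) (K : TwoFunctor B D) :
  PsFunctor A D.
Proof.
refine {| F0 := fun x => proj1_sig K (F x);
          F1 := fun x y u => F1 (proj1_sig K) (F1 F u);
          F2 := fun x y a => F2 (proj1_sig K) (F2 F a);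
          Fc := fun x y z u v => F2 (proj1_sig K) (Fc F u v);
          Fu := fun x => F2 (proj1_sig K) (Fu F x) |};
  case: K => K sK /=.
- by bd.
- by bd.
- by move=> *; rewrite -strict_comp //; bd.
- by bd.
- by move=> *; rewrite -strict_id //; bd.
- by bd.
- by move=> *; rewrite !F2_id2.
- by move=> x y a b e; rewrite !F2_vc //; bd.
- by move=> *; apply/F2_invertible/inv_Fc.
- by move=> *; apply/F2_invertible/inv_Fu.
- move=> x y z a b.
  rewrite -strict_hcomp // -F2_vc; first by bd.
  by rewrite nat_Fc F2_vc //; bd.
- move=> x y z t u v w.
  rewrite -!(F2_id2 K) -!strict_hcomp // -!(F2_vc K); try by bd.
  by rewrite FcA.
- move=> x y u.
  rewrite -!(F2_id2 K) -!strict_hcomp // -!(F2_vc K); try by bd.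
  by rewrite Fc1l.
- move=> x y u.
  rewrite -!(F2_id2 K) -!strict_hcomp // -!(F2_vc K); try by bd.
  by rewrite Fc1r.
Defined.

Definition psnat_post (A B D : TwoCat) (F G : PsFunctor A B) (al : PsNat F G)
  (K : TwoFunctor B D) : PsNat (ps_post F K) (ps_post G K).
Proof.
refine (@Build_PsNat A D (ps_post F K) (ps_post G K)
          (fun x => F1 (proj1_sig K) (N1 al x))
          (fun x y u => F2 (proj1_sig K) (N2 al u))
          _ _ _ _ _ _); case: K => K sK /=.
- by move=> *; rewrite -strict_comp //; bd.
- by move=> *; rewrite -strict_comp //; bd.
- by move=> *; apply/F2_invertible/inv_N2.
- move=> x y a.
  rewrite -!(F2_id2 K) -!strict_hcomp // -!(F2_vc K); try by bd.
  by rewrite nat_N2.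
- move=> x y z u v.
  rewrite -!(F2_id2 K) -!strict_hcomp // -!(F2_vc K); try by bd.
  by rewrite N2_comp.
- move=> x.
  rewrite -!(F2_id2 K) -!strict_hcomp // -!(F2_vc K); try by bd.
  by rewrite N2_id.
Defined.

Definition post_TwoRep (A B D : TwoCat) (K : TwoFunctor B D) :
  Functor (TwoRep A B) (TwoRep A D).
Proof.
refine (@Build_Functor (TwoRep A B) (TwoRep A D) (fun F => ps_post F K)
          (fun F G al => psnat_post al K) _ _); case: K => K sK.
- move=> F; apply: psnat_ext => [x | x y u] /=; first exact: strict_id.
  by rewrite F2_id2.
- move=> F G H al be; apply: psnat_ext => [x | x y u] /=.
    exact: strict_comp.
  rewrite F2_vc; first by bd.
  by rewrite !strict_hcomp // !F2_id2.
Defined.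

Lemma strict_post (A B D : TwoCat) (F : PsFunctor A B) (K : TwoFunctor B D) :
  strict F -> strict (ps_post F K).
Proof.
case: K => K sK [s1 s2]; split=> [x y z u v | x] /=.
  by rewrite s1 F2_id2 strict_comp.
by rewrite s2 F2_id2 strict_id.
Qed.

Definition post_TwoCatFun (A B D : TwoCat) (K : TwoFunctor B D) :
  Functor (TwoCatFun A B) (TwoCatFun A D).
Proof.
refine (@Build_Functor (TwoCatFun A B) (TwoCatFun A D)
          (fun F => exist _ (ps_post (proj1_sig F) K)
                            (strict_post K (proj2_sig F)))
          (fun F G al => psnat_post al K) _ _).
- by move=> F; apply: (fmap_id (post_TwoRep A K)).
- by move=> F G H al be; apply: (fmap_comp (post_TwoRep A K)).
Defined.

(** [quot R] is the type of equivalence classes of [R], which is always used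
    with an equivalence relation; operations on it go through
    representatives. *)
Definition quot (T : Type) (R : T -> T -> Prop) : Type :=
  {P : T -> Prop | exists a, P = R a}.

Definition cls (T : Type) (R : T -> T -> Prop) (a : T) : quot R :=
  exist _ (R a) (ex_intro _ a eq_refl).

Definition repr (T : Type) (R : T -> T -> Prop) (q : quot R) : T :=
  proj1_sig (constructive_indefinite_description _ (proj2_sig q)).

Lemma reprK (T : Type) (R : T -> T -> Prop) (q : quot R) : cls R (repr q) = q.
Proof.
rewrite /repr; case: (constructive_indefinite_description _ _) => a /=.
case: q => P p /= e; subst P; congr (exist _ _ _); exact: proof_irrelevance.
Qed.

Lemma cls_eq (T : Type) (R : T -> T -> Prop) (eqR : Equivalence R) (a b : T) :
  cls R a = cls R b <-> R a b.
Proof.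
split=> [e | rab].
  have {}e : R a = R b by case: e.
  by rewrite e; reflexivity.
have e : R a = R b.
  apply: functional_extensionality => c; apply: propositional_extensionality.
  by split=> r; [rewrite -rab | rewrite rab].
rewrite /cls; move: (ex_intro _ a _); rewrite e => p.
congr (exist _ _ _); exact: proof_irrelevance.
Qed.

Lemma repr_cls (T : Type) (R : T -> T -> Prop) (eqR : Equivalence R) (a : T) :
  R (repr (cls R a)) a.
Proof. by apply/cls_eq; rewrite reprK. Qed.

Inductive cong1 (C : Category) (R : forall x y : C, hom x y -> hom x y -> Prop) :
  forall x y : C, hom x y -> hom x y -> Prop :=
| cong1_gen x y (f g : hom x y) : R x y f g -> cong1 R f g
| cong1_refl x y (f : hom x y) : cong1 R f f
| cong1_sym x y (f g : hom x y) : cong1 R f g -> cong1 R g f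
| cong1_trans x y (f g h : hom x y) :
    cong1 R f g -> cong1 R g h -> cong1 R f h
| cong1_comp x y z (f f' : hom x y) (g g' : hom y z) :
    cong1 R f f' -> cong1 R g g' -> cong1 R (f · g) (f' · g').

#[export] Instance cong1_equiv (C : Category)
  (R : forall x y : C, hom x y -> hom x y -> Prop) (x y : C) :
  Equivalence (@cong1 C R x y).
Proof.
split; [exact: cong1_refl | exact: cong1_sym | exact: cong1_trans].
Qed.

Definition quot_cat (C : Category)
  (R : forall x y : C, hom x y -> hom x y -> Prop) : Category.
Proof.
refine {| ob := C; hom := fun x y => quot (@cong1 C R x y);
          id1 := fun x => cls _ (id1 x);
          comp := fun x y z f g => cls _ (repr f · repr g) |}.
- move=> x y z t f g h; apply/cls_eq.
  apply: cong1_trans (cong1_comp (repr_cls _ _) (cong1_refl _ _)) _.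
  apply: cong1_trans (cong1_comp (cong1_refl _ _) (cong1_sym (repr_cls _ _))).
  by rewrite compA; apply: cong1_refl.
- move=> x y f; rewrite -[RHS]reprK; apply/cls_eq.
  apply: cong1_trans (cong1_comp (repr_cls _ _) (cong1_refl _ _)) _.
  by rewrite comp1l; apply: cong1_refl.
- move=> x y f; rewrite -[RHS]reprK; apply/cls_eq.
  apply: cong1_trans (cong1_comp (cong1_refl _ _) (repr_cls _ _)) _.
  by rewrite comp1r; apply: cong1_refl.
Defined.

Definition parallel (A : TwoCat) (x y : A) (a b : cell x y) : Prop :=
  src a = src b /\ tgt a = tgt b.

Inductive cong2 (A : TwoCat)
  (R : forall x y : A, cell x y -> cell x y -> Prop) :
  forall x y : A, cell x y -> cell x y -> Prop :=
| cong2_gen x y (a b : cell x y) : R x y a b -> cong2 R a b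
| cong2_refl x y (a : cell x y) : cong2 R a a
| cong2_sym x y (a b : cell x y) : cong2 R a b -> cong2 R b a
| cong2_trans x y (a b c : cell x y) :
    cong2 R a b -> cong2 R b c -> cong2 R a c
| cong2_vcomp x y (a a' b b' : cell x y) e e' :
    cong2 R a a' -> cong2 R b b' -> cong2 R (vcomp a b e) (vcomp a' b' e')
| cong2_hcomp x y z (a a' : cell x y) (b b' : cell y z) :
    cong2 R a a' -> cong2 R b b' -> cong2 R (a ⋆₀ b) (a' ⋆₀ b').

#[export] Instance cong2_equiv (A : TwoCat)
  (R : forall x y : A, cell x y -> cell x y -> Prop) (x y : A) :
  Equivalence (@cong2 A R x y).
Proof.
split; [exact: cong2_refl | exact: cong2_sym | exact: cong2_trans].
Qed.

Lemma cong2_parallel (A : TwoCat)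
  (R : forall x y : A, cell x y -> cell x y -> Prop)
  (parR : forall (x y : A) (a b : cell x y), R x y a b -> parallel a b)
  (x y : A) (a b : cell x y) : cong2 R a b -> parallel a b.
Proof.
elim=> {x y a b}.
- exact: parR.
- by [].
- by move=> x y a b _ [s t].
- by move=> x y a b c _ [s t] _ [s' t']; split; congruence.
- by move=> x y a a' b b' e e' _ [s _] _ [_ t];
    split; rewrite ?src_vcomp ?tgt_vcomp.
- by move=> x y z a a' b b' _ [s t] _ [s' t'];
    split; rewrite ?src_hcomp ?tgt_hcomp; congruence.
Qed.

Lemma src_repr (A : TwoCat)
  (R : forall x y : A, cell x y -> cell x y -> Prop)
  (parR : forall (x y : A) (a b : cell x y), R x y a b -> parallel a b)
  (x y : A) (a : cell x y) : src (repr (cls (@cong2 A R x y) a)) = src a.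
Proof. exact: (proj1 (cong2_parallel parR (repr_cls _ a))). Qed.

Lemma tgt_repr (A : TwoCat)
  (R : forall x y : A, cell x y -> cell x y -> Prop)
  (parR : forall (x y : A) (a b : cell x y), R x y a b -> parallel a b)
  (x y : A) (a : cell x y) : tgt (repr (cls (@cong2 A R x y) a)) = tgt a.
Proof. exact: (proj2 (cong2_parallel parR (repr_cls _ a))). Qed.

Definition quot_twocat (A : TwoCat)
  (R : forall x y : A, cell x y -> cell x y -> Prop)
  (parR : forall (x y : A) (a b : cell x y), R x y a b -> parallel a b) :
  TwoCat.
Proof.
refine {| cat1 := A; cell := fun x y => quot (@cong2 A R x y);
          src := fun x y q => src (repr q); tgt := fun x y q => tgt (repr q);
          id2 := fun x y u => cls _ (id2 u);
          vcomp := fun x y p q e => cls _ (vcomp (repr p) (repr q) e);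
          hcomp := fun x y z p q => cls _ (repr p ⋆₀ repr q) |}.
- by move=> x y u; rewrite (src_repr parR) src_id2.
- by move=> x y u; rewrite (tgt_repr parR) tgt_id2.
- by move=> x y p q e; rewrite (src_repr parR) src_vcomp.
- by move=> x y p q e; rewrite (tgt_repr parR) tgt_vcomp.
- by move=> x y z p q; rewrite (src_repr parR) src_hcomp.
- by move=> x y z p q; rewrite (tgt_repr parR) tgt_hcomp.
- move=> x y p q r e1 e2 e3 e4; apply/cls_eq.
  have f2 : tgt (vcomp (repr p) (repr q) e1) = src (repr r).
    by rewrite tgt_vcomp.
  have f4 : tgt (repr p) = src (vcomp (repr q) (repr r) e3).
    by rewrite src_vcomp.
  apply: cong2_trans (cong2_vcomp e2 f2 (repr_cls _ _) (cong2_refl _ _)) _.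
  rewrite (vcompA f2 f4); apply: cong2_sym.
  exact: cong2_vcomp (cong2_refl _ _) (repr_cls _ _).
- move=> x y p e; rewrite -[RHS]reprK; apply/cls_eq.
  have f : tgt (id2 (src (repr p))) = src (repr p) by rewrite tgt_id2.
  apply: cong2_trans (cong2_vcomp e f (repr_cls _ _) (cong2_refl _ _)) _.
  by rewrite vcomp1l; apply: cong2_refl.
- move=> x y p e; rewrite -[RHS]reprK; apply/cls_eq.
  have f : tgt (repr p) = src (id2 (tgt (repr p))) by rewrite src_id2.
  apply: cong2_trans (cong2_vcomp e f (cong2_refl _ _) (repr_cls _ _)) _.
  by rewrite vcomp1r; apply: cong2_refl.
- move=> x y z t p q r; apply/cls_eq.
  apply: cong2_trans (cong2_hcomp (repr_cls _ _) (cong2_refl _ _)) _.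
  rewrite hcompA; apply: cong2_sym.
  exact: cong2_hcomp (cong2_refl _ _) (repr_cls _ _).
- move=> x y p; rewrite -[RHS]reprK; apply/cls_eq.
  apply: cong2_trans (cong2_hcomp (repr_cls _ _) (cong2_refl _ _)) _.
  by rewrite hcomp1l; apply: cong2_refl.
- move=> x y p; rewrite -[RHS]reprK; apply/cls_eq.
  apply: cong2_trans (cong2_hcomp (cong2_refl _ _) (repr_cls _ _)) _.
  by rewrite hcomp1r; apply: cong2_refl.
- move=> x y z u v; apply/cls_eq; rewrite -hcomp_id2.
  exact: cong2_hcomp (repr_cls _ _) (repr_cls _ _).
- move=> x y z p q r s e1 e2 e3; apply/cls_eq.
  have f : tgt (repr p ⋆₀ repr r) = src (repr q ⋆₀ repr s).
    by rewrite tgt_hcomp src_hcomp e1 e2.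
  apply: cong2_trans (cong2_hcomp (repr_cls _ _) (repr_cls _ _)) _.
  rewrite (interchange e1 e2 f); apply: cong2_sym.
  exact: cong2_vcomp (repr_cls _ _) (repr_cls _ _).
Defined.

Definition quot_cell (A : TwoCat)
  (R : forall x y : A, cell x y -> cell x y -> Prop)
  (parR : forall (x y : A) (a b : cell x y), R x y a b -> parallel a b)
  (x y : A) (a : cell x y) : @cell (quot_twocat parR) x y :=
  cls (@cong2 A R x y) a.

Inductive path (V : Type) (E : V -> V -> Type) : V -> V -> Type :=
| pnil x : path E x x
| pcons x y z : E x y -> path E y z -> path E x z.

Arguments pnil {V E} x.
Arguments pcons {V E x y z} _ _.

Fixpoint pcat (V : Type) (E : V -> V -> Type) (x y z : V) (p : path E x y) :
  path E y z -> path E x z :=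
  match p in path _ x y return path E y z -> path E x z with
  | pnil _ => fun q => q
  | pcons e p' => fun q => pcons e (pcat p' q)
  end.

Definition free_cat (V : Type) (E : V -> V -> Type) : Category.
Proof.
refine {| ob := V; hom := path E; id1 := @pnil V E; comp := @pcat V E |}.
- by move=> x y z t p q r; elim: p q => //= {}x {}y w e p IH q; rewrite IH.
- by [].
- by move=> x y p; elim: p => //= {}x {}y w e p ->.
Defined.

(** Sets of generating cells with source and target maps are encoded as
    families indexed by their boundaries, so that parallelism of the two
    boundary 1-cells of a generating 2-cell is automatic. *)
Record Polygraph2 := {
  S0 : Type;
  S1 : S0 -> S0 -> Type;
  S2 : forall x y : free_cat S1, hom x y -> hom x y -> Type }.

Definition presented_category (P : Polygraph2) : Category :=
  @quot_cat (free_cat (@S1 P)) (fun x y u v => inhabited (S2 u v)).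

Inductive term (P : Polygraph2) :
  forall x y : free_cat (@S1 P), hom x y -> hom x y -> Type :=
| t_gen x y (u v : @hom (free_cat (@S1 P)) x y) : S2 u v -> term u v
| t_id x y (u : @hom (free_cat (@S1 P)) x y) : term u u
| t_vcomp x y (u v w : @hom (free_cat (@S1 P)) x y) :
    term u v -> term v w -> term u w
| t_hcomp x y z (u v : @hom (free_cat (@S1 P)) x y)
    (u' v' : @hom (free_cat (@S1 P)) y z) :
    term u v -> term u' v' -> term (u · u') (v · v')
| t_inv x y (u v : @hom (free_cat (@S1 P)) x y) : term u v -> term v u.

(** Terms bundled with their boundary, so that relations between terms may
    compare terms whose boundaries are equal only propositionally. *)
Record bterm (P : Polygraph2) (x y : free_cat (@S1 P)) := BTerm {
  bsrc : hom x y;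
  btgt : hom x y;
  bbody : term bsrc btgt }.

Definition b_id (P : Polygraph2) (x y : free_cat (@S1 P)) (u : hom x y) :
  bterm x y := BTerm (t_id u).

Definition b_vcomp (P : Polygraph2) (x y : free_cat (@S1 P)) (a b : bterm x y)
  (e : btgt a = bsrc b) : bterm x y :=
  BTerm (t_vcomp (eq_rect _ (fun v => term (bsrc a) v) (bbody a) _ e)
                 (bbody b)).

Arguments b_vcomp {P x y} a b e.

Definition b_hcomp (P : Polygraph2) (x y z : free_cat (@S1 P))
  (a : bterm x y) (b : bterm y z) : bterm x z :=
  BTerm (t_hcomp (bbody a) (bbody b)).

Definition b_inv (P : Polygraph2) (x y : free_cat (@S1 P)) (a : bterm x y) :
  bterm x y := BTerm (t_inv (bbody a)).

(** The least congruence on terms making them the 2-cells of a 2-category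
    with inverses for vertical composition. *)
Inductive beq (P : Polygraph2) :
  forall x y : free_cat (@S1 P), bterm x y -> bterm x y -> Prop :=
| beq_refl x y (a : @bterm P x y) : beq a a
| beq_sym x y (a b : @bterm P x y) : beq a b -> beq b a
| beq_trans x y (a b c : @bterm P x y) : beq a b -> beq b c -> beq a c
| beq_vcomp x y (a a' b b' : @bterm P x y) e e' :
    beq a a' -> beq b b' -> beq (b_vcomp a b e) (b_vcomp a' b' e')
| beq_hcomp x y z (a a' : @bterm P x y) (b b' : @bterm P y z) :
    beq a a' -> beq b b' -> beq (b_hcomp a b) (b_hcomp a' b')
| beq_vcompA x y (a b c : @bterm P x y) e1 e2 e3 e4 :
    beq (b_vcomp (b_vcomp a b e1) c e2)
        (b_vcomp a (b_vcomp b c e3) e4)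
| beq_vcomp1l x y (a : @bterm P x y) e :
    beq (b_vcomp (b_id (bsrc a)) a e) a
| beq_vcomp1r x y (a : @bterm P x y) e :
    beq (b_vcomp a (b_id (btgt a)) e) a
| beq_hcompA x y z t (a : @bterm P x y) (b : @bterm P y z) (c : @bterm P z t) :
    beq (b_hcomp (b_hcomp a b) c) (b_hcomp a (b_hcomp b c))
| beq_hcomp1l x y (a : @bterm P x y) : beq (b_hcomp (b_id (id1 x)) a) a
| beq_hcomp1r x y (a : @bterm P x y) : beq (b_hcomp a (b_id (id1 y))) a
| beq_hcomp_id x y z (u : @hom (free_cat (@S1 P)) x y)
    (v : @hom (free_cat (@S1 P)) y z) :
    beq (b_hcomp (b_id u) (b_id v)) (b_id (u · v))
| beq_interchange x y z (a b : @bterm P x y) (c d : @bterm P y z) e1 e2 e3 :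
    beq (b_hcomp (b_vcomp a b e1) (b_vcomp c d e2))
        (b_vcomp (b_hcomp a c) (b_hcomp b d) e3)
| beq_inv_r x y (a : @bterm P x y) e :
    beq (b_vcomp a (b_inv a) e) (b_id (bsrc a))
| beq_inv_l x y (a : @bterm P x y) e :
    beq (b_vcomp (b_inv a) a e) (b_id (btgt a)).

#[export] Instance beq_equiv (P : Polygraph2) (x y : free_cat (@S1 P)) :
  Equivalence (@beq P x y).
Proof. split; [exact: beq_refl | exact: beq_sym | exact: beq_trans]. Qed.

Lemma beq_parallel (P : Polygraph2) (x y : free_cat (@S1 P))
  (a b : bterm x y) : beq a b -> bsrc a = bsrc b /\ btgt a = btgt b.
Proof.
elim=> {x y a b} //.
- by move=> x y a b _ [s t].
- by move=> x y a b c _ [s t] _ [s' t']; split; congruence.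
- by move=> x y a a' b b' e e' _ [s _] _ [_ t].
- by move=> x y z a a' b b' _ [s t] _ [s' t']; rewrite /= s t s' t'.
- by move=> x y z t a b c; split; apply: compA.
- by move=> x y a; split; apply: comp1r.
Qed.

Lemma bsrc_repr (P : Polygraph2) (x y : free_cat (@S1 P)) (a : bterm x y) :
  bsrc (repr (cls (@beq P x y) a)) = bsrc a.
Proof. exact: (proj1 (beq_parallel (repr_cls _ a))). Qed.

Lemma btgt_repr (P : Polygraph2) (x y : free_cat (@S1 P)) (a : bterm x y) :
  btgt (repr (cls (@beq P x y) a)) = btgt a.
Proof. exact: (proj2 (beq_parallel (repr_cls _ a))). Qed.

Definition free_21 (P : Polygraph2) : TwoCat.
Proof.
refine {| cat1 := free_cat (@S1 P); cell := fun x y => quot (@beq P x y);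
          src := fun x y q => bsrc (repr q);
          tgt := fun x y q => btgt (repr q);
          id2 := fun x y u => cls _ (b_id u);
          vcomp := fun x y p q e => cls _ (b_vcomp (repr p) (repr q) e);
          hcomp := fun x y z p q => cls _ (b_hcomp (repr p) (repr q)) |}.
- by move=> x y u; rewrite bsrc_repr.
- by move=> x y u; rewrite btgt_repr.
- by move=> x y p q e; rewrite bsrc_repr.
- by move=> x y p q e; rewrite btgt_repr.
- by move=> x y z p q; rewrite bsrc_repr.
- by move=> x y z p q; rewrite btgt_repr.
- move=> x y p q r e1 e2 e3 e4; apply/cls_eq.
  have f2 : btgt (b_vcomp (repr p) (repr q) e1) = bsrc (repr r) by [].
  have f4 : btgt (repr p) = bsrc (b_vcomp (repr q) (repr r) e3) by [].
  have h1 := beq_vcomp e2 f2 (repr_cls (beq_equiv _ _) _) (beq_refl (repr r)).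
  have h2 := beq_vcomp e4 f4 (beq_refl (repr p)) (repr_cls (beq_equiv _ _) _).
  exact: beq_trans (beq_trans h1 (beq_vcompA f2 f4)) (beq_sym h2).
- move=> x y p e; rewrite -[RHS]reprK; apply/cls_eq.
  have f : btgt (b_id (bsrc (repr p))) = bsrc (repr p) by [].
  have h := beq_vcomp e f (repr_cls (beq_equiv _ _) _) (beq_refl (repr p)).
  exact: beq_trans h (beq_vcomp1l f).
- move=> x y p e; rewrite -[RHS]reprK; apply/cls_eq.
  have f : btgt (repr p) = bsrc (b_id (btgt (repr p))) by [].
  have h := beq_vcomp e f (beq_refl (repr p)) (repr_cls (beq_equiv _ _) _).
  exact: beq_trans h (beq_vcomp1r f).
- move=> x y z t p q r; apply/cls_eq.
  apply: beq_trans (beq_hcomp (repr_cls (beq_equiv _ _) _) (beq_refl _)) _.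
  apply: beq_trans (beq_hcompA _ _ _) _; apply: beq_sym.
  exact: beq_hcomp (beq_refl _) (repr_cls (beq_equiv _ _) _).
- move=> x y p; rewrite -[RHS]reprK; apply/cls_eq.
  apply: beq_trans (beq_hcomp (repr_cls (beq_equiv _ _) _) (beq_refl _)) _.
  exact: beq_hcomp1l.
- move=> x y p; rewrite -[RHS]reprK; apply/cls_eq.
  apply: beq_trans (beq_hcomp (beq_refl _) (repr_cls (beq_equiv _ _) _)) _.
  exact: beq_hcomp1r.
- move=> x y z u v; apply/cls_eq.
  apply: beq_trans (beq_hcomp (repr_cls (beq_equiv _ _) _) (repr_cls (beq_equiv _ _) _)) _.
  exact: beq_hcomp_id.
- move=> x y z p q r s e1 e2 e3; apply/cls_eq.
  have f : btgt (b_hcomp (repr p) (repr r)) = bsrc (b_hcomp (repr q) (repr s)).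
    by rewrite /= e1 e2.
  apply: beq_trans (beq_hcomp (repr_cls (beq_equiv _ _) _) (repr_cls (beq_equiv _ _) _)) _.
  apply: beq_trans (beq_interchange e1 e2 f) _; apply: beq_sym.
  exact: beq_vcomp (repr_cls (beq_equiv _ _) _) (repr_cls (beq_equiv _ _) _).
Defined.

Record Polygraph31 := {
  P2 :> Polygraph2;
  S3 : forall x y : free_21 P2, cell x y -> cell x y -> Type;
  S3_parallel : forall (x y : free_21 P2) (a b : cell x y),
    S3 a b -> parallel a b }.

Definition rel3 (S : Polygraph31) (x y : free_21 S) (a b : cell x y) : Prop :=
  inhabited (S3 a b).

Lemma rel3_parallel (S : Polygraph31) (x y : free_21 S) (a b : cell x y) :
  rel3 a b -> parallel a b.
Proof. by case; apply: S3_parallel. Qed.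

Definition presented_21 (S : Polygraph31) : TwoCat :=
  quot_twocat (@rel3_parallel S).

(** [quot_cell] is the projection from [free_21 S] to [presented_21 S]. *)
Definition homotopy_basis (S : Polygraph31) : Prop :=
  forall (x y : free_21 S) (a b : cell x y),
    parallel a b ->
    quot_cell (@rel3_parallel S) a = quot_cell (@rel3_parallel S) b.

Definition extended_presentation (S : Polygraph31) (C : Category) : Prop :=
  isomorphic (presented_category S) C.

Definition coherent_presentation (S : Polygraph31) (C : Category) : Prop :=
  extended_presentation S C /\ homotopy_basis S.

(* Main.v *)
(** Let [Q] be the category presented by [S] and [E] the 2-category whose 1-cells
    are the paths of [S] and which has exactly one 2-cell between two paths
    that are equal in [Q].  A pseudofunctor [F : Q -> D] yields a strict
    2-functor [strictify F : E -> D]: on a path, compose the images of its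
    edges; the coherence cells of [F] compare the result with the image of the
    composite, and the 2-cells of [E] are sent to the resulting comparison
    cells.  Along this comparison [strictify] is isomorphic to precomposition
    with the projection [E -> Q], which is fully faithful; a choice of
    representatives is a pseudofunctor [Q -> E], which makes [strictify]
    essentially surjective onto strict 2-functors.  It commutes on the nose
    with postcomposition by strict 2-functors.

    If [S] is coherent, then the 2-category it presents is isomorphic to [E],
    and (ii) follows.  Conversely, given equivalences [Phi] as in (ii), choose
    a pseudofunctor [M] with [Phi M] isomorphic to the identity.  Up to
    isomorphism [M] factors through the universal pseudofunctor into [E]
    followed by a strict 2-functor, so by naturality the identity of the
    presented 2-category factors, up to isomorphism, through [E], where
    parallel 2-cells are equal. *)
From Corelib Require Import ssreflect.
From Stdlib Require Import FunctionalExtensionality ProofIrrelevance.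
From Stdlib Require Import ClassicalEpsilon JMeq RelationClasses.
Require Import Defs.

Set Implicit Arguments.
Unset Strict Implicit.
Unset Printing Implicit Defensive.

(** * Functors *)

Lemma functor_ext (A B : Category) (F G : Functor A B) :
  (forall x, F x = G x) ->
  (forall x y (f : hom x y), JMeq (fmap F f) (fmap G f)) -> F = G.
Proof.
case: F G => [o m p q] [o' m' p' q'] /= eo.
have {}eo : o = o' by apply: functional_extensionality.
subst o' => em.
have {}em : m = m'.
  by do 3!(apply: functional_extensionality_dep => ?); apply: JMeq_eq.
by subst m'; f_equal; apply: proof_irrelevance.
Qed.

Lemma compFA (A B C D : Category) (F : Functor A B) (G : Functor B C)
  (H : Functor C D) : compF (compF F G) H = compF F (compF G H).
Proof. exact: functor_ext. Qed.

Definition fully_faithful (A B : Category) (F : Functor A B) : Prop :=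
  (forall x y (f g : hom x y), fmap F f = fmap F g -> f = g) /\
  (forall x y (g : hom (F x) (F y)), exists f : hom x y, fmap F f = g).

Definition iso_ob (A : Category) (x y : A) : Prop :=
  exists f : hom x y, is_iso f.

Lemma iso_ob_sym (A : Category) (x y : A) : iso_ob x y -> iso_ob y x.
Proof. by move=> [f [g [fg gf]]]; exists g, f. Qed.

Lemma is_iso_comp (A : Category) (x y z : A) (f : hom x y) (g : hom y z) :
  is_iso f -> is_iso g -> is_iso (f · g).
Proof.
move=> [f' [ff' f'f]] [g' [gg' g'g]]; exists (g' · f'); split.
- by rewrite compA -(compA g) gg' comp1l.
- by rewrite compA -(compA f') f'f comp1l.
Qed.

Lemma iso_ob_trans (A : Category) (x y z : A) :
  iso_ob x y -> iso_ob y z -> iso_ob x z.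
Proof. by move=> [f fi] [g gi]; exists (f · g); apply: is_iso_comp. Qed.

Lemma fmap_iso (A B : Category) (F : Functor A B) (x y : A) :
  iso_ob x y -> iso_ob (F x) (F y).
Proof.
move=> [f [g [fg gf]]]; exists (fmap F f), (fmap F g).
by rewrite -!fmap_comp fg gf !fmap_id.
Qed.

Lemma fully_faithful_reflects_iso (A B : Category) (F : Functor A B)
  (x y : A) : fully_faithful F -> iso_ob (F x) (F y) -> iso_ob x y.
Proof.
move=> [faith full] [g [g' [gg' g'g]]].
have [f ef] := full _ _ g; have [f' ef'] := full _ _ g'.
by exists f, f'; split; apply: faith; rewrite fmap_comp ef ef' fmap_id.
Qed.

Lemma fully_faithful_comp (A B C : Category) (F : Functor A B)
  (G : Functor B C) :
  fully_faithful F -> fully_faithful G -> fully_faithful (compF F G).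
Proof.
move=> [fF uF] [fG uG]; split=> [x y f g /= /fG /fF // | x y h /=].
by have [g <-] := uG _ _ h; have [f <-] := uF _ _ g; exists f.
Qed.

(** The round trip is the identity only up to propositional equality, so [idff] rewrites the whole
    functor instead of transporting single arrows. A left inverse gives faithfulness; for fullness,
    lift [fmap G g] along [compF F G] and use that [G] is faithful. *)
Lemma inverse_fully_faithful (A B : Category) (F : Functor A B)
  (G : Functor B A) :
  compF F G = idF A -> compF G F = idF B -> fully_faithful F.
Proof.
have idff : forall (X : Category) (U : Functor X X), U = idF X ->
    fully_faithful U.
  by move=> X U ->; split=> // x y g; exists g.
have faith : forall (X Y : Category) (H : Functor X Y) (K : Functor Y X),
    compF H K = idF X -> forall x y (f g : hom x y),
    fmap H f = fmap H g -> f = g.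
  move=> X Y H K /idff [h _] x y f g e; apply: h => /=; by rewrite e.
move=> FG GF; split; first exact: faith FG.
move=> x y g; have [_ full] := idff _ _ FG.
have [f ef] := full x y (fmap G g); exists f.
exact: faith GF _ _ _ _ ef.
Qed.

Lemma is_equivalence_iso_ob (A B : Category) (F : Functor A B) (y : B) :
  is_equivalence F -> exists x : A, iso_ob (F x) y.
Proof.
move=> [G [_ [eta [etai _]]]]; exists (G y), (eta y); exact: etai.
Qed.

Lemma equivalence_of_fully_faithful (A B : Category) (F : Functor A B) :
  fully_faithful F -> (forall y, exists x, iso_ob (F x) y) ->
  is_equivalence F.
Proof.
move=> [faith full] es.
pose g0 y := proj1_sig (constructive_indefinite_description _ (es y)).
have Hg0 y : iso_ob (F (g0 y)) y :=
  proj2_sig (constructive_indefinite_description _ (es y)).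
pose e y := proj1_sig (constructive_indefinite_description _ (Hg0 y)).
have He y : is_iso (e y) :=
  proj2_sig (constructive_indefinite_description _ (Hg0 y)).
pose e' y := proj1_sig (constructive_indefinite_description _ (He y)).
have ee' y : e y · e' y = id1 _.
  by rewrite /e'; case: (constructive_indefinite_description _ _) => ? [].
have e'e y : e' y · e y = id1 _.
  by rewrite /e'; case: (constructive_indefinite_description _ _) => ? [].
pose precomp x y (f : hom (F x) (F y)) :=
  proj1_sig (constructive_indefinite_description _ (full x y f)).
have preE x y f : fmap F (@precomp x y f) = f.
  by rewrite /precomp; case: (constructive_indefinite_description _ _).
(* On arrows the quasi-inverse conjugates by the chosen isomorphisms [e] and takes the preimage
   under [F]; its laws are checked after applying [F]. *)
have gid (x : B) : precomp _ _ (e x · id1 x · e' x) = id1 (g0 x).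
  by apply: faith; rewrite preE fmap_id comp1r ee'.
have gcomp (x y z : B) (f : hom x y) (g : hom y z) :
    precomp _ _ (e x · (f · g) · e' z)
    = precomp _ _ (e x · f · e' y) · precomp _ _ (e y · g · e' z).
  apply: faith; rewrite fmap_comp !preE.
  by rewrite !compA -(compA (e' y)) e'e comp1l.
exists (Build_Functor gid gcomp).
split.
- exists (fun x => precomp _ _ (e (F x))); split=> [x | x y f] /=.
    exists (precomp _ _ (e' (F x))).
    by split; apply: faith; rewrite fmap_comp !preE ?fmap_id.
  apply: faith; rewrite !fmap_comp !preE.
  by rewrite !compA e'e comp1r.
- exists e; split=> [y | x y f] /=; first exact: He.
  by rewrite preE !compA e'e comp1r.
Qed.

Definition corestrict (A B : Category) (P : B -> Prop) (F : Functor A B)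
  (h : forall x, P (F x)) : Functor A (full_subcategory P).
Proof.
refine (@Build_Functor A (full_subcategory P) (fun x => exist _ (F x) (h x))
          (fun x y f => fmap F f) _ _).
- exact: fmap_id.
- by move=> x y z f g; apply: fmap_comp.
Defined.

Lemma corestrict_eq (A B : Category) (P : B -> Prop) (F G : Functor A B)
  (hF : forall x, P (F x)) (hG : forall x, P (G x)) :
  F = G -> corestrict hF = corestrict hG.
Proof. by move=> e; subst G; rewrite (proof_irrelevance _ hF hG). Qed.

Lemma corestrict_equivalence (A B : Category) (P : B -> Prop)
  (F : Functor A B) (h : forall x, P (F x)) :
  fully_faithful F -> (forall y, P y -> exists x, iso_ob (F x) y) ->
  is_equivalence (corestrict h).
Proof.
move=> ffF es; apply: equivalence_of_fully_faithful => [|[y Py]].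
  exact: ffF.
by have [x [f [g fg]]] := es y Py; exists x, f, g.
Qed.

(** * Pseudofunctors and pseudonatural isomorphisms *)

(** Heterogeneous equality is used because the types of the other components depend on the object
    map. *)
Lemma psfunctor_ext (A B : TwoCat) (F G : PsFunctor A B) :
  F0 F = F0 G -> JMeq (@F1 _ _ F) (@F1 _ _ G) ->
  JMeq (@F2 _ _ F) (@F2 _ _ G) -> JMeq (@Fc _ _ F) (@Fc _ _ G) ->
  JMeq (@Fu _ _ F) (@Fu _ _ G) -> F = G.
Proof.
case: F => [a0 a1 a2 a3 a4 p1 p2 p3 p4 p5 p6 p7 p8 p9 p10 p11 p12 p13 p14].
case: G => [b0 b1 b2 b3 b4 q1 q2 q3 q4 q5 q6 q7 q8 q9 q10 q11 q12 q13 q14] /=.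
move=> e0; subst b0 => e1 e2 e3 e4.
move: (JMeq_eq e1) (JMeq_eq e2) (JMeq_eq e3) (JMeq_eq e4) => *.
subst b1 b2 b3 b4.
have ? := proof_irrelevance _ p1 q1; subst q1.
have ? := proof_irrelevance _ p2 q2; subst q2.
have ? := proof_irrelevance _ p3 q3; subst q3.
have ? := proof_irrelevance _ p4 q4; subst q4.
have ? := proof_irrelevance _ p5 q5; subst q5.
have ? := proof_irrelevance _ p6 q6; subst q6.
have ? := proof_irrelevance _ p7 q7; subst q7.
have ? := proof_irrelevance _ p8 q8; subst q8.
have ? := proof_irrelevance _ p9 q9; subst q9.
have ? := proof_irrelevance _ p10 q10; subst q10.
have ? := proof_irrelevance _ p11 q11; subst q11.
have ? := proof_irrelevance _ p12 q12; subst q12.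
have ? := proof_irrelevance _ p13 q13; subst q13.
have ? := proof_irrelevance _ p14 q14; subst q14.
by [].
Qed.

Lemma eq_JMeq (T : Type) (x y : T) : x = y -> JMeq x y.
Proof. by move=> ->. Qed.

Lemma psnat_JMeq (A B : TwoCat) (F G F' G' : PsFunctor A B)
  (al : PsNat F G) (be : PsNat F' G') :
  F = F' -> G = G' -> (forall x, JMeq (N1 al x) (N1 be x)) ->
  (forall x y (u : hom x y), JMeq (N2 al u) (N2 be u)) -> JMeq al be.
Proof.
move=> eF eG; subst F' G' => e1 e2.
rewrite (@psnat_ext _ _ _ _ al be) // => [x | x y u]; exact: JMeq_eq.
Qed.

(** The argument itself serves as junk value when it is not invertible. *)
Definition vinv (A : TwoCat) (x y : A) (a : cell x y) : cell x y :=
  match excluded_middle_informative (invertible a) with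
  | left h => proj1_sig (constructive_indefinite_description _ h)
  | right _ => a
  end.

Lemma vinvP (A : TwoCat) (x y : A) (a : cell x y) : invertible a ->
  src (vinv a) = tgt a /\ tgt (vinv a) = src a /\
  a ⋆₁ vinv a = id2 (src a) /\ vinv a ⋆₁ a = id2 (tgt a).
Proof.
rewrite /vinv; case: (excluded_middle_informative _) => // h _.
by case: (constructive_indefinite_description _ _).
Qed.

Lemma src_vinv (A : TwoCat) (x y : A) (a : cell x y) :
  invertible a -> src (vinv a) = tgt a.
Proof. by case/vinvP. Qed.

Lemma tgt_vinv (A : TwoCat) (x y : A) (a : cell x y) :
  invertible a -> tgt (vinv a) = src a.
Proof. by case/vinvP => _ []. Qed.

Lemma vc_vinvr (A : TwoCat) (x y : A) (a : cell x y) :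
  invertible a -> a ⋆₁ vinv a = id2 (src a).
Proof. by case/vinvP => _ [_ []]. Qed.

Lemma vc_vinvl (A : TwoCat) (x y : A) (a : cell x y) :
  invertible a -> vinv a ⋆₁ a = id2 (tgt a).
Proof. by case/vinvP => _ [_ []]. Qed.

Create HintDb inv discriminated.
#[local] Hint Resolve inv_N2 inv_Fc inv_Fu invertible_id2 invertible_hcomp
  F2_invertible : inv.

Ltac bnd_step :=
  first [ rewrite src_hcomp | rewrite tgt_hcomp
        | rewrite src_id2 | rewrite tgt_id2
        | rewrite src_F2 | rewrite tgt_F2 | rewrite src_Fc | rewrite tgt_Fc
        | rewrite src_Fu | rewrite tgt_Fu | rewrite src_N2 | rewrite tgt_N2
        | rewrite src_vinv; [solve [eauto with inv] |]
        | rewrite tgt_vinv; [solve [eauto with inv] |]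
        | rewrite comp1l | rewrite comp1r | rewrite compA
        | rewrite src_vc; [solve [bnd] |] | rewrite tgt_vc; [solve [bnd] |] ]
with bnd := intros; repeat bnd_step; try reflexivity; try congruence.

Lemma invertible_vinv (A : TwoCat) (x y : A) (a : cell x y) :
  invertible a -> invertible (vinv a).
Proof.
move=> /vinvP [e1 [e2 [e3 e4]]]; exists a; by rewrite e1 e2.
Qed.
#[local] Hint Resolve invertible_vinv : inv.

Lemma vinv_unique (A : TwoCat) (x y : A) (a b : cell x y) :
  invertible a -> src b = tgt a -> a ⋆₁ b = id2 (src a) -> vinv a = b.
Proof.
move=> ia e1 ab.
have e2 : tgt b = src a by rewrite -(tgt_id2 (src a)) -ab; bnd.
by rewrite -[LHS](vc1r (u := src a)) -?ab ?tgt_vinv // -vcA ?vc_vinvl ?vc1l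
  ?tgt_vinv.
Qed.

Lemma vinv_vc (A : TwoCat) (x y : A) (a b : cell x y) :
  invertible a -> invertible b -> tgt a = src b ->
  vinv (a ⋆₁ b) = vinv b ⋆₁ vinv a.
Proof.
move=> ia ib e; apply: vinv_unique.
- exact: invertible_vc.
- by bnd.
- rewrite vcA; [by []|by bnd|].
  rewrite -(vcA (a := b)); [by bnd|by bnd|].
  by rewrite vc_vinvr // vc1l ?src_vinv // vc_vinvr // src_vc.
Qed.

Lemma vinv_hcomp (A : TwoCat) (x y z : A) (a : cell x y) (b : cell y z) :
  invertible a -> invertible b -> vinv (a ⋆₀ b) = vinv a ⋆₀ vinv b.
Proof.
move=> ia ib; apply: vinv_unique; [by auto with inv|by bnd|].
rewrite -vc_hcomp; [by bnd|by bnd|].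
by rewrite !vc_vinvr // hcomp_id2 src_hcomp.
Qed.

Lemma vinv_id2 (A : TwoCat) (x y : A) (u : hom x y) : vinv (id2 u) = id2 u.
Proof.
by apply: vinv_unique; [exact: invertible_id2|bnd|rewrite vc1l; bnd].
Qed.

Lemma F2_vinv (A B : TwoCat) (K : PsFunctor A B) (x y : A) (a : cell x y) :
  invertible a -> F2 K (vinv a) = vinv (F2 K a).
Proof.
move=> ia; symmetry; apply: vinv_unique.
- exact: F2_invertible.
- by bnd.
- by rewrite -F2_vc ?src_vinv // vc_vinvr // F2_id2 src_F2.
Qed.

(** Solving a commuting square for the inverses of two opposite sides; this turns each axiom of a
    pseudonatural transformation into the one for its inverse. *)
Lemma vinv_swap (A : TwoCat) (x y : A) (a b p q : cell x y) :
  invertible p -> invertible q -> tgt a = src q -> tgt p = src b ->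
  a ⋆₁ q = p ⋆₁ b -> vinv p ⋆₁ a = b ⋆₁ vinv q.
Proof.
move=> ip iq eaq epb e.
have esrc : src p = src a by rewrite -(src_vc eaq) e src_vc.
have etgt : tgt b = tgt q by rewrite -(tgt_vc eaq) e tgt_vc.
transitivity (vinv p ⋆₁ (a ⋆₁ q) ⋆₁ vinv q).
  rewrite -vcA; [by bnd|by []|].
  rewrite (vcA (b := q)); [by bnd|by bnd|].
  by rewrite vc_vinvr // vc1r //; bnd.
rewrite e -vcA; [by bnd|by []|].
by rewrite vc_vinvl // vc1l.
Qed.

Lemma hcomp_sectionK (A : TwoCat) (x y z : A) (f : hom x y) (g : hom y x)
  (b : cell x z) : f · g = id1 x -> id2 f ⋆₀ (id2 g ⋆₀ b) = b.
Proof. by move=> e; rewrite -hcompA hcomp_id2 e hcomp1l. Qed.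

Lemma comp_sectionK (A : Category) (x y z : A) (f : hom x y) (g : hom y x)
  (b : hom x z) : f · g = id1 x -> f · (g · b) = b.
Proof. by move=> e; rewrite -compA e comp1l. Qed.

(** Isomorphisms in [TwoRep] have strictly invertible 1-cell components. Conversely, such components
    suffice: the 2-cells of the inverse are the inverses of [N2 al] whiskered by [g] on both
    sides. *)
Definition psnat_inv (A B : TwoCat) (F G : PsFunctor A B) (al : PsNat F G)
  (g : forall x, hom (G x) (F x)) (gl : forall x, N1 al x · g x = id1 (F x))
  (gr : forall x, g x · N1 al x = id1 (G x)) : PsNat G F.
Proof.
refine {| N1 := g;
          N2 := fun x y u => id2 (g x) ⋆₀ (vinv (N2 al u) ⋆₀ id2 (g y)) |}.
- by bnd; rewrite comp_sectionK.
- by bnd; rewrite gl comp1r.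
- by eauto 7 with inv.
- move=> x y a.
  (* Each of the three axioms follows this pattern: solve the axiom of [al] for the inverses,
     whisker by [g] on both sides, and cancel [g] against [N1 al]. *)
  have H : vinv (N2 al (src a)) ⋆₁ F2 F a ⋆₀ id2 (N1 al y)
         = id2 (N1 al x) ⋆₀ F2 G a ⋆₁ vinv (N2 al (tgt a)).
    by apply: vinv_swap; auto with inv; [bnd|bnd|exact: nat_N2].
  have := f_equal (fun c => id2 (g x) ⋆₀ (c ⋆₀ id2 (g y))) H.
  rewrite !whisk_r; [by bnd|by bnd|].
  rewrite !whisk_l; [by bnd|by bnd|].
  by rewrite !hcompA (hcomp_sectionK _ (gr x)) (hcomp_id2 (N1 al y)) gl hcomp1r.
- move=> x y z u v.
  have H : vinv (id2 (F1 F u) ⋆₀ N2 al v ⋆₁ N2 al u ⋆₀ id2 (F1 G v))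
             ⋆₁ Fc F u v ⋆₀ id2 (N1 al z)
         = id2 (N1 al x) ⋆₀ Fc G u v ⋆₁ vinv (N2 al (u · v)).
    apply: vinv_swap; [|by auto with inv|by bnd|by bnd|exact: N2_comp].
    by apply: invertible_vc; auto with inv; bnd.
  move: H; rewrite vinv_vc; auto with inv; first by bnd.
  rewrite !vinv_hcomp; auto with inv; rewrite !vinv_id2 => H.
  have := f_equal (fun c => id2 (g x) ⋆₀ (c ⋆₀ id2 (g z))) H.
  rewrite !whisk_r; try by bnd.
  rewrite !whisk_l; try by bnd.
  rewrite !hcompA (hcomp_sectionK _ (gr x)) (hcomp_id2 (N1 al z)) gl
    hcomp1r => <-.
  congr (_ ⋆₁ _).
  (* The inverse components at [u] and [v] occur in opposite orders on the two sides; they act on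
     different factors, so the exchange law applies. *)
  have := exchange (id2 (g x) ⋆₀ vinv (N2 al u) ⋆₀ id2 (g y))
                   (vinv (N2 al v) ⋆₀ id2 (g z)).
  rewrite !src_hcomp !tgt_hcomp !src_id2 !tgt_id2.
  rewrite !src_vinv ?tgt_vinv; auto with inv.
  rewrite !src_N2 !tgt_N2 !compA (comp_sectionK _ (gr x)).
  by rewrite !gl !comp1r -!hcomp_id2 !hcompA (hcomp_sectionK _ (gr y)) => ->.
- move=> x.
  have H : vinv (id2 (N1 al x)) ⋆₁ Fu F x ⋆₀ id2 (N1 al x)
         = id2 (N1 al x) ⋆₀ Fu G x ⋆₁ vinv (N2 al (id1 x)).
    apply: vinv_swap; auto with inv; [by bnd|by bnd|].
    by rewrite vc1l; [bnd|exact: N2_id].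
  have := f_equal (fun c => id2 (g x) ⋆₀ (c ⋆₀ id2 (g x))) H.
  rewrite vinv_id2 !whisk_r; try by bnd.
  rewrite !whisk_l; try by bnd.
  rewrite !hcompA !(hcomp_sectionK _ (gr x)) (hcomp_id2 (N1 al x)) gl
    !hcomp1r => <-.
  by rewrite vc1l; bnd.
Defined.

Lemma psnat_iso (A B : TwoCat) (F G : PsFunctor A B) (al : PsNat F G)
  (g : forall x, hom (G x) (F x)) (gl : forall x, N1 al x · g x = id1 (F x))
  (gr : forall x, g x · N1 al x = id1 (G x)) :
  psnat_comp al (psnat_inv gl gr) = psnat_id F /\
  psnat_comp (psnat_inv gl gr) al = psnat_id G.
Proof.
split; apply: psnat_ext => [x | x y u] /=; auto.
- rewrite -(hcompA (id2 (N1 al x))) hcomp_id2 gl hcomp1l -whisk_r; first by bnd.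
  rewrite vc_vinvr; auto with inv.
  by rewrite src_N2 hcomp_id2 compA gl comp1r.
- rewrite !hcompA hcomp_id2 gr hcomp1r -whisk_l; first by bnd.
  rewrite vc_vinvl; auto with inv.
  by rewrite tgt_N2 hcomp_id2 -compA gr comp1l.
Qed.

Lemma iso_ob_psnat (A B : TwoCat) (F G : PsFunctor A B) (al : PsNat F G)
  (g : forall x, hom (G x) (F x)) :
  (forall x, N1 al x · g x = id1 (F x)) ->
  (forall x, g x · N1 al x = id1 (G x)) -> iso_ob (A := TwoRep A B) F G.
Proof.
by move=> gl gr; exists al, (psnat_inv gl gr); apply: psnat_iso.
Qed.

(** * Strict 2-functors and precomposition *)

Definition strict_2functor (A B : TwoCat) (f0 : A -> B)
  (f1 : forall x y, hom x y -> hom (f0 x) (f0 y))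
  (f2 : forall x y, cell x y -> cell (f0 x) (f0 y))
  (f1_id : forall x, f1 x x (id1 x) = id1 (f0 x))
  (f1_comp : forall x y z (u : hom x y) (v : hom y z),
    f1 _ _ (u · v) = f1 _ _ u · f1 _ _ v)
  (src_f2 : forall x y (a : cell x y), src (f2 _ _ a) = f1 _ _ (src a))
  (tgt_f2 : forall x y (a : cell x y), tgt (f2 _ _ a) = f1 _ _ (tgt a))
  (f2_id2 : forall x y (u : hom x y), f2 _ _ (id2 u) = id2 (f1 _ _ u))
  (f2_vc : forall x y (a b : cell x y), tgt a = src b ->
    f2 _ _ (a ⋆₁ b) = f2 _ _ a ⋆₁ f2 _ _ b)
  (f2_hcomp : forall x y z (a : cell x y) (b : cell y z),
    f2 _ _ (a ⋆₀ b) = f2 _ _ a ⋆₀ f2 _ _ b) : TwoFunctor A B.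
Proof.
unshelve refine (exist _ {| F0 := f0; F1 := f1; F2 := f2;
  Fc := fun x y z u v => id2 (f1 _ _ u · f1 _ _ v);
  Fu := fun x => id2 (id1 (f0 x)) |} _) => //.
- by move=> *; rewrite src_id2.
- by move=> *; rewrite tgt_id2 f1_comp.
- by move=> *; rewrite src_id2.
- by move=> *; rewrite tgt_id2 f1_id.
- by move=> *; apply: invertible_id2.
- by move=> *; apply: invertible_id2.
- move=> x y z a b; rewrite f2_hcomp vc1r ?vc1l // ?tgt_hcomp ?src_hcomp.
    by rewrite !tgt_f2.
  by rewrite !src_f2.
- move=> x y z t u v w.
  by rewrite !hcomp_id2 !f1_comp !vc1r ?tgt_id2 // compA.
- by move=> x y u; rewrite f1_id comp1l hcomp_id2 comp1l vc1r ?tgt_id2.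
- by move=> x y u; rewrite f1_id comp1r hcomp_id2 comp1r vc1r ?tgt_id2.
Defined.

Definition id2F (A : TwoCat) : TwoFunctor A A.
Proof.
by refine (@strict_2functor A A (fun x => x) (fun x y u => u) (fun x y a => a)
             _ _ _ _ _ _ _).
Defined.

Definition comp2F (A B D : TwoCat) (H : TwoFunctor A B) (K : TwoFunctor B D) :
  TwoFunctor A D :=
  exist _ (ps_post (proj1_sig H) K) (strict_post K (proj2_sig H)).

(** Since [H] is strict, the images under [F] of its coherence cells are identities and are left
    out, as in [ps_post]. *)
Definition ps_pre (A B D : TwoCat) (H : TwoFunctor A B) (F : PsFunctor B D) :
  PsFunctor A D.
Proof.
refine {| F0 := fun x => F (proj1_sig H x);
          F1 := fun x y u => F1 F (F1 (proj1_sig H) u);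
          F2 := fun x y a => F2 F (F2 (proj1_sig H) a);
          Fc := fun x y z u v => Fc F (F1 (proj1_sig H) u) (F1 (proj1_sig H) v);
          Fu := fun x => Fu F (proj1_sig H x) |};
  case: H => H sH /=.
- by bnd.
- by bnd.
- by bnd.
- by move=> *; rewrite strict_comp //; bnd.
- by bnd.
- by move=> *; rewrite strict_id //; bnd.
- by move=> *; rewrite !F2_id2.
- by move=> x y a b e; rewrite !F2_vc //; bnd.
- by move=> *; apply: inv_Fc.
- by move=> *; apply: inv_Fu.
- move=> x y z a b; rewrite strict_hcomp //.
  by have := nat_Fc F (F2 H a) (F2 H b); rewrite !src_F2 !tgt_F2.
- by move=> x y z t u v w; rewrite !strict_comp // FcA.
- by move=> x y u; rewrite strict_id // Fc1l.
- by move=> x y u; rewrite strict_id // Fc1r.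
Defined.

Definition psnat_pre (A B D : TwoCat) (H : TwoFunctor A B)
  (F G : PsFunctor B D) (al : PsNat F G) : PsNat (ps_pre H F) (ps_pre H G).
Proof.
refine (@Build_PsNat A D (ps_pre H F) (ps_pre H G)
          (fun x => N1 al (proj1_sig H x))
          (fun x y u => N2 al (F1 (proj1_sig H) u))
          _ _ _ _ _ _); case: H => H sH /=.
- by bnd.
- by bnd.
- by move=> *; apply: inv_N2.
- by move=> x y a; have := nat_N2 al (F2 H a); rewrite src_F2 tgt_F2.
- by move=> x y z u v; rewrite strict_comp // N2_comp.
- by move=> x; rewrite strict_id // N2_id.
Defined.

Definition precomp (A B D : TwoCat) (H : TwoFunctor A B) :
  Functor (TwoRep B D) (TwoRep A D).
Proof.
refine (@Build_Functor (TwoRep B D) (TwoRep A D) (ps_pre H)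
          (fun F G al => psnat_pre H al) _ _).
- by move=> F; apply: psnat_ext.
- by move=> F G K al be; apply: psnat_ext.
Defined.

Arguments precomp {A B D} H.

Lemma strict_pre (A B D : TwoCat) (H : TwoFunctor A B) (F : PsFunctor B D) :
  strict F -> strict (ps_pre H F).
Proof. by move=> [s1 s2]; split=> [x y z u v | x] /=; rewrite ?s1 ?s2. Qed.

Lemma precomp_id2F (A D : TwoCat) : precomp (id2F A) = idF (TwoRep A D).
Proof.
have e F : ps_pre (id2F A) F = F :> PsFunctor A D by apply: psfunctor_ext.
apply: functor_ext => [F | F G al]; first exact: e.
by apply: psnat_JMeq; try exact: e.
Qed.

Lemma precomp_comp2F (A B D E : TwoCat) (H : TwoFunctor A B)
  (K : TwoFunctor B D) :
  compF (precomp K) (precomp H) = precomp (comp2F H K) :> Functor (TwoRep D E) _.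
Proof.
have e F : ps_pre H (ps_pre K F) = ps_pre (comp2F H K) F
  :> PsFunctor A E by apply: psfunctor_ext.
apply: functor_ext => [F | F G al]; first exact: e.
by apply: psnat_JMeq; try exact: e.
Qed.

Lemma precomp_post (A B D E : TwoCat) (H : TwoFunctor A B) (K : TwoFunctor D E) :
  compF (precomp H) (post_TwoRep A K) = compF (post_TwoRep B K) (precomp H).
Proof.
have e F : ps_post (ps_pre H F) K = ps_pre H (ps_post F K)
  :> PsFunctor A E by apply: psfunctor_ext.
apply: functor_ext => [F | F G al]; first exact: e.
by apply: psnat_JMeq; try exact: e.
Qed.

(** Strictness determines the coherence cells from the action on objects and 1-cells. *)
Lemma two_functor_ext (A B : TwoCat) (H K : TwoFunctor A B) :
  F0 (proj1_sig H) = F0 (proj1_sig K) ->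
  JMeq (@F1 _ _ (proj1_sig H)) (@F1 _ _ (proj1_sig K)) ->
  JMeq (@F2 _ _ (proj1_sig H)) (@F2 _ _ (proj1_sig K)) -> H = K.
Proof.
case: H K => [H sH] [K sK] /= e0 e1 e2.
have FcE (L : PsFunctor A B) : strict L ->
    @Fc _ _ L = fun x y z u v => id2 (F1 L u · F1 L v).
  by move=> [h _]; do 5!(apply: functional_extensionality_dep => ?).
have FuE (L : PsFunctor A B) : strict L -> Fu L = fun x => id2 (id1 (L x)).
  by move=> [_ h]; apply: functional_extensionality_dep.
have e : H = K.
  apply: psfunctor_ext => //.
    rewrite !FcE //; move: e1; move: (@F1 _ _ H) (@F1 _ _ K).
    rewrite e0 => h1 k1 e1; by rewrite (JMeq_eq e1).
  by rewrite !FuE // e0.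
subst K; congr exist; exact: proof_irrelevance.
Qed.

Lemma precomp_inverse (A B D : TwoCat) (H : TwoFunctor A B) (K : TwoFunctor B A) :
  comp2F H K = id2F A -> comp2F K H = id2F B ->
  compF (precomp K) (precomp H) = idF (TwoRep A D) /\
  compF (precomp H) (precomp K) = idF (TwoRep B D).
Proof. by move=> HK KH; rewrite !precomp_comp2F HK KH !precomp_id2F. Qed.

Definition discrete_functor (A B : Category) (F : Functor A B) :
  TwoFunctor (locally_discrete A) (locally_discrete B).
Proof.
refine (@strict_2functor (locally_discrete A) (locally_discrete B)
  F (fun x y u => fmap F u) (fun x y u => fmap F u) _ _ _ _ _ _ _) => //.
- exact: fmap_id.
- exact: fmap_comp.
- move=> x y a b e; rewrite (vcE e).
  have e' : @tgt (locally_discrete B) _ _ (fmap F a)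
          = @src (locally_discrete B) _ _ (fmap F b).
    exact: (f_equal (fun h : hom x y => fmap F h) e).
  by rewrite (vcE e').
- exact: fmap_comp.
Defined.

Lemma discrete_functor_comp (A B C : Category) (F : Functor A B)
  (G : Functor B C) :
  comp2F (discrete_functor F) (discrete_functor G)
  = discrete_functor (compF F G).
Proof.
apply: two_functor_ext => /=;
  [exact: eq_refl | exact: JMeq_refl | exact: JMeq_refl].
Qed.

Lemma discrete_functor_id (A : Category) :
  discrete_functor (idF A) = id2F (locally_discrete A).
Proof.
apply: two_functor_ext => /=;
  [exact: eq_refl | exact: JMeq_refl | exact: JMeq_refl].
Qed.

(** * The locally codiscrete 2-category of a congruence *)

Section Congruence.
Variables (X : Category) (R : forall x y : X, hom x y -> hom x y -> Prop).

(** The cells of the 2-category [E] of the overview, over any category [X]. By proof irrelevance a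
    cell is determined by its boundary, so laws between 2-cells reduce to laws between 1-cells. *)
Record cong_cell (x y : X) := CongCell {
  csrc : hom x y;
  ctgt : hom x y;
  ccong : cong1 R csrc ctgt }.

Lemma cong_cell_ext (x y : X) (a b : cong_cell x y) :
  csrc a = csrc b -> ctgt a = ctgt b -> a = b.
Proof.
case: a b => [u v p] [u' v' p'] /= e e'; subst u' v'.
by rewrite (proof_irrelevance _ p p').
Qed.

Definition cong_twocat : TwoCat.
Proof.
refine {| cat1 := X; cell := cong_cell; src := csrc; tgt := ctgt;
  id2 := fun x y u => CongCell (cong1_refl R u);
  vcomp := fun x y a b e => CongCell (cong1_trans (ccong a)
    (eq_ind_r (fun w => cong1 R w (ctgt b)) (ccong b) e));
  hcomp := fun x y z a b =>
    CongCell (cong1_comp (ccong a) (ccong b)) |} => //.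
- by move=> *; apply: cong_cell_ext.
- by move=> *; apply: cong_cell_ext.
- by move=> *; apply: cong_cell_ext.
- by move=> *; apply: cong_cell_ext; apply: compA.
- by move=> *; apply: cong_cell_ext; apply: comp1l.
- by move=> *; apply: cong_cell_ext; apply: comp1r.
- by move=> *; apply: cong_cell_ext.
- by move=> *; apply: cong_cell_ext.
Defined.

Lemma cong_twocat_ext (x y : cong_twocat) (a b : cell x y) :
  src a = src b -> tgt a = tgt b -> a = b.
Proof. exact: cong_cell_ext. Qed.

Lemma src_vc_cong_twocat (x y : X) (a b : @cell cong_twocat x y) :
  tgt a = src b -> src (a ⋆₁ b) = csrc a.
Proof. by move=> e; rewrite src_vc. Qed.

Lemma tgt_vc_cong_twocat (x y : X) (a b : @cell cong_twocat x y) :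
  tgt a = src b -> tgt (a ⋆₁ b) = ctgt b.
Proof. by move=> e; rewrite tgt_vc. Qed.

Lemma csrc_vc_cong_twocat (x y : X) (a b : @cell cong_twocat x y) :
  tgt a = src b -> csrc (a ⋆₁ b) = csrc a.
Proof. exact: src_vc_cong_twocat. Qed.

Lemma ctgt_vc_cong_twocat (x y : X) (a b : @cell cong_twocat x y) :
  tgt a = src b -> ctgt (a ⋆₁ b) = ctgt b.
Proof. exact: tgt_vc_cong_twocat. Qed.

Lemma cong_twocat_invertible (x y : cong_twocat) (a : cell x y) : invertible a.
Proof.
pose b : @cell cong_twocat x y := CongCell (cong1_sym (ccong a)).
exists b; split=> //; split=> //.
by split; apply: cong_twocat_ext; rewrite ?src_vc ?tgt_vc ?src_id2 ?tgt_id2.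
Qed.

Ltac cong_bd :=
  apply: cong_twocat_ext; rewrite !(src_vc_cong_twocat, tgt_vc_cong_twocat) /=;
  rewrite ?csrc_vc_cong_twocat ?ctgt_vc_cong_twocat /=;
  rewrite ?(@comp1l X) ?(@comp1r X) ?(@compA X) ?(@comp1l X) ?(@comp1r X) //.

Definition quot_map (x y : X) (u : hom x y) : @hom (quot_cat R) x y :=
  cls (@cong1 X R x y) u.

Lemma quot_map_comp (x y z : X) (u : hom x y) (v : hom y z) :
  quot_map (u · v) = quot_map u · quot_map v.
Proof.
by apply/cls_eq; apply: cong1_sym; apply: cong1_comp; apply: repr_cls.
Qed.

Lemma quot_map_cell (x y : cong_twocat) (a : cell x y) :
  quot_map (src a) = quot_map (tgt a).
Proof. apply/cls_eq; exact: ccong. Qed.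

Definition cong_proj : TwoFunctor cong_twocat (locally_discrete (quot_cat R)).
Proof.
refine (@strict_2functor cong_twocat (locally_discrete (quot_cat R))
  (fun x => x) (fun x y u => quot_map u) (fun x y a => quot_map (csrc a))
  _ _ _ _ _ _ _) => //.
- by move=> x y z u v; apply: quot_map_comp.
- by move=> x y a; apply: quot_map_cell.
- move=> x y a b e; rewrite (vcE e).
  have e' : @tgt (locally_discrete (quot_cat R)) _ _ (quot_map (csrc a))
    = @src (locally_discrete (quot_cat R)) _ _ (quot_map (csrc b)).
    by move: (quot_map_cell a) e => /= -> ->.
  by rewrite (vcE e').
- by move=> x y z a b; apply: quot_map_comp.
Defined.

Lemma vc_discrete (A : Category) (x y : locally_discrete A) (a b : cell x y) :
  tgt a = src b -> a ⋆₁ b = a.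
Proof. by move=> e; rewrite (vcE e). Qed.

Lemma cong_repr_comp (x y z : X) (u : @hom (quot_cat R) x y)
  (v : @hom (quot_cat R) y z) : cong1 R (repr u · repr v) (repr (u · v)).
Proof. by apply: cong1_sym; apply: repr_cls. Qed.

Lemma cong_repr_id (x : X) : cong1 R (id1 x) (repr (@id1 (quot_cat R) x)).
Proof. by apply: cong1_sym; apply: repr_cls. Qed.

(** Representatives are not chosen compatibly with composition, so this is a pseudofunctor: the
    coherence cells record that the composite of representatives is congruent to the representative
    of the composite. *)
Definition cong_section : PsFunctor (locally_discrete (quot_cat R)) cong_twocat.
Proof.
unshelve refine (@Build_PsFunctor (locally_discrete (quot_cat R)) cong_twocat
  (fun x => x) (fun x y u => repr u)
  (fun x y a => @id2 cong_twocat x y (repr a))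
  (fun x y z u v => CongCell (cong_repr_comp u v))
  (fun x => CongCell (cong_repr_id x)) _ _ _ _ _ _ _ _ _ _ _ _ _ _) => //.
- by move=> x y a b /= e; subst b; rewrite vc_discrete // vc1l.
- by move=> *; apply: cong_twocat_invertible.
- by move=> *; apply: cong_twocat_invertible.
- by move=> *; cong_bd.
- by move=> x y z t u v w; cong_bd; f_equal; apply: (@compA (quot_cat R)).
- by move=> x y u; cong_bd; f_equal; apply: (@comp1l (quot_cat R)).
- by move=> x y u; cong_bd; f_equal; apply: (@comp1r (quot_cat R)).
Defined.

(** The isomorphism has identity 1-cells, and its 2-cell at [u] relates the representative of the
    class of [u] to [u]. *)
Lemma cong_proj_cong_section :
  iso_ob (A := TwoRep cong_twocat cong_twocat) (ps_pre cong_proj cong_section)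
    (proj1_sig (id2F cong_twocat)).
Proof.
have cong_repr (x y : X) (u : hom x y) :
    cong1 R (repr (quot_map u) · id1 y) (id1 x · u).
  by rewrite comp1l comp1r; apply: repr_cls.
unshelve eapply (@iso_ob_psnat cong_twocat cong_twocat _ _
  (@Build_PsNat cong_twocat cong_twocat (ps_pre cong_proj cong_section)
     (proj1_sig (id2F cong_twocat))
     (@id1 X) (fun x y u => CongCell (cong_repr x y u))
     _ _ _ _ _ _) (@id1 X)) => //=.
- by move=> *; apply: cong_twocat_invertible.
- by move=> x y a; have /= e := quot_map_cell a; cong_bd; rewrite e.
- by move=> x y z u v; have /= e := quot_map_comp u v; cong_bd; rewrite e.
- by move=> x; cong_bd.
- by move=> x; apply: (@comp1l X).
- by move=> x; apply: (@comp1l X).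
Qed.
End Congruence.

(** * Strictification of pseudofunctors on a quotient of a free category *)

Section Strictification.
Variables (V : Type) (E : V -> V -> Type).
Let X := free_cat E.
Variable R : forall x y : X, hom x y -> hom x y -> Prop.
Let Q := quot_cat R.

Definition edge (x y : V) (e : E x y) : @hom X x y := pcons e (pnil y).

Section Object.
Variables (D : TwoCat) (F : PsFunctor (locally_discrete Q) D).

Fixpoint path_map (x y : V) (p : path E x y) : hom (F x) (F y) :=
  match p in path _ x y return hom (F x) (F y) with
  | pnil x => id1 (F x)
  | pcons e p' => F1 F (quot_map R (edge e)) · path_map p'
  end.

(** The comparison from the composite of the images of the edges to the image of the class of the
    path, built from iterated coherence cells of [F]. *)
Fixpoint path_cell (x y : V) (p : path E x y) : cell (F x) (F y) :=
  match p in path _ x y return cell (F x) (F y) with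
  | pnil x => Fu F x
  | pcons e p' => id2 (F1 F (quot_map R (edge e))) ⋆₀ path_cell p'
                  ⋆₁ Fc F (quot_map R (edge e)) (quot_map R (p' : @hom X _ _))
  end.

Lemma path_map_cat (x y z : V) (p : path E x y) (q : path E y z) :
  path_map (pcat p q) = path_map p · path_map q.
Proof.
by elim: p q => [w | {}x w {}y e p IH] q /=; rewrite ?comp1l ?IH ?compA.
Qed.

Lemma quot_map_cons (x y z : V) (e : E x y) (p : path E y z) :
  quot_map R (pcons e p : @hom X x z)
  = quot_map R (edge e) · quot_map R (p : @hom X y z).
Proof. by rewrite -quot_map_comp. Qed.

Lemma path_cellP (x y : V) (p : path E x y) :
  src (path_cell p) = path_map p /\
  tgt (path_cell p) = F1 F (quot_map R (p : @hom X x y)) /\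
  invertible (path_cell p).
Proof.
elim: p => [w | {}x w {}y e p [s [t i]]] /=.
  by split; [|split]; [exact: src_Fu | exact: tgt_Fu | exact: inv_Fu].
rewrite quot_map_cons; split; [|split]; [by bnd | by bnd |].
by apply: invertible_vc; [bnd | auto with inv | auto with inv].
Qed.

Lemma src_path_cell (x y : V) (p : path E x y) :
  src (path_cell p) = path_map p.
Proof. by case: (path_cellP p) => ? []. Qed.

Lemma tgt_path_cell (x y : V) (p : path E x y) :
  tgt (path_cell p) = F1 F (quot_map R (p : @hom X x y)).
Proof. by case: (path_cellP p) => ? []. Qed.

Lemma inv_path_cell (x y : V) (p : path E x y) : invertible (path_cell p).
Proof. by case: (path_cellP p) => ? []. Qed.
#[local] Hint Resolve inv_path_cell : inv.

(** The coherence of [F] for concatenation: the left unit law settles the empty path, and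
    associativity moves one more edge across. *)
Lemma path_cell_cat (x y z : V) (p : path E x y) (q : path E y z) :
  path_cell (pcat p q)
  = path_cell p ⋆₀ path_cell q
    ⋆₁ Fc F (quot_map R (p : @hom X x y)) (quot_map R (q : @hom X y z)).
Proof.
elim: p q => [w | {}x w {}y e p IH] q /=.
  (* Padding with identities splits [Fu F w ⋆₀ path_cell q] into [path_cell q] followed by a
     whiskering of [Fu F w], to which [Fc1l] applies. *)
  have := vc_hcomp (a := id2 (id1 (F w))) (b := Fu F w) (c := path_cell q)
    (d := id2 (F1 F (quot_map R (q : @hom X w z)))).
  rewrite hcomp1l vc1l ?vc1r ?src_Fu ?tgt_path_cell // => ->; [by bnd|by bnd|].
  rewrite vcA ?tgt_path_cell; [by bnd | by bnd |].
  have := Fc1l F (quot_map R (q : @hom X w z)); rewrite /quot_map /= => ->.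
  by rewrite vc1r // tgt_path_cell.
rewrite IH whisk_l; first by rewrite tgt_hcomp !tgt_path_cell src_Fc.
have e1 : quot_map R (pcat p q : @hom X w z)
        = quot_map R (p : @hom X w y) · quot_map R (q : @hom X y z).
  exact: quot_map_comp.
rewrite e1 quot_map_cons.
rewrite vcA; [by bnd; rewrite !tgt_path_cell|by bnd|].
rewrite -FcA -vcA; [by bnd; rewrite !tgt_path_cell|by bnd|].
congr (_ ⋆₁ _).
rewrite -hcompA -vc_hcomp ?vc1r ?tgt_path_cell //.
  by bnd; rewrite tgt_path_cell.
by bnd.
Qed.

Lemma path_cell_tgt (x y : V) (a : @cell (cong_twocat R) x y) :
  tgt (path_cell (csrc a)) = tgt (path_cell (ctgt a)).
Proof. rewrite !tgt_path_cell; congr F1; exact: (quot_map_cell a). Qed.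

Definition strictify : TwoFunctor (cong_twocat R) D.
Proof.
refine (@strict_2functor (cong_twocat R) D (fun x => F x) path_map
  (fun x y a => path_cell (csrc a) ⋆₁ vinv (path_cell (ctgt a)))
  _ _ _ _ _ _ _) => //.
- exact: path_map_cat.
- move=> x y a; rewrite src_vc ?src_path_cell //.
  by rewrite src_vinv ?path_cell_tgt; auto with inv.
- move=> x y a; have i := inv_path_cell (ctgt a).
  rewrite tgt_vc ?tgt_vinv ?src_path_cell //.
  by rewrite src_vinv ?path_cell_tgt.
- by move=> x y u; rewrite /= vc_vinvr ?src_path_cell; auto with inv.
- move=> x y a b e; have ia := inv_path_cell (ctgt a).
  have ib := inv_path_cell (ctgt b).
  have ea := path_cell_tgt a; have eb := path_cell_tgt b.
  have ec : ctgt a = csrc b by [].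
  rewrite csrc_vc_cong_twocat // ctgt_vc_cong_twocat // vcA;
    [by rewrite src_vinv| |].
    by rewrite src_vc ?tgt_vinv ?src_vinv // ec.
  rewrite -(vcA (a := vinv _)); [by rewrite tgt_vinv // ec| |].
    by rewrite src_vinv.
  by rewrite -ec vc_vinvl // vc1l // src_vinv // -eb -ec.
- move=> x y z a b.
  have ia := inv_path_cell (ctgt a); have ib := inv_path_cell (ctgt b).
  have ea := path_cell_tgt a; have eb := path_cell_tgt b.
  rewrite /= !path_cell_cat vinv_vc; auto with inv.
    by bnd; rewrite !tgt_path_cell.
  rewrite vinv_hcomp // vc_hcomp ?src_vinv //.
  (* Congruent paths have equal classes, so the source and the target paths involve one and the same
     coherence cell [c], which cancels against its inverse. *)
  have -> : quot_map R (csrc a) = quot_map R (ctgt a)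
    by exact: (quot_map_cell a).
  have -> : quot_map R (csrc b) = quot_map R (ctgt b)
    by exact: (quot_map_cell b).
  set c := Fc F _ _; have ic : invertible c by exact: inv_Fc.
  have sc : src c = tgt (path_cell (ctgt a) ⋆₀ path_cell (ctgt b)).
    by rewrite src_Fc tgt_hcomp !tgt_path_cell.
  have st : src (vinv (path_cell (ctgt a)) ⋆₀ vinv (path_cell (ctgt b)))
       = tgt (path_cell (ctgt a) ⋆₀ path_cell (ctgt b)).
    by rewrite src_hcomp !src_vinv // tgt_hcomp.
  rewrite vcA; [by rewrite tgt_hcomp ea eb sc tgt_hcomp| |].
    by rewrite src_vc ?src_vinv ?tgt_vinv // sc st.
  rewrite -(vcA (a := c)) ?vc_vinvr ?tgt_vinv ?src_vinv // ?sc ?st //.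
  by rewrite vc1l.
Defined.

(** The 1-cell components are identities, and the axiom for composites amounts to
    [path_cell_cat]. *)
Definition strictify_cmp : PsNat (proj1_sig strictify) (ps_pre (cong_proj R) F).
Proof.
refine (@Build_PsNat _ _ (proj1_sig strictify) (ps_pre (cong_proj R) F)
  (fun x => id1 (F x)) (fun x y u => path_cell u) _ _ _ _ _ _) => /=.
- by move=> x y u; rewrite src_path_cell comp1r.
- by move=> x y u; rewrite tgt_path_cell comp1l.
- by move=> x y u; apply: inv_path_cell.
- move=> x y a; have i := inv_path_cell (ctgt a).
  have ea := path_cell_tgt a.
  rewrite hcomp1l hcomp1r vcA ?src_vinv ?tgt_vinv // vc_vinvl //.
  have /= -> := @F2_id2 _ _ F x y (quot_map R (csrc a)).
  by rewrite -ea tgt_path_cell.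
- move=> x y z u v; rewrite !hcomp1l hcomp1r path_cell_cat.
  rewrite vc1l; first by rewrite src_vc ?src_hcomp ?src_path_cell //;
    rewrite tgt_hcomp src_Fc !tgt_path_cell.
  by rewrite -vc_hcomp ?vc1l ?vc1r ?tgt_path_cell ?src_path_cell ?tgt_id2
    ?src_id2.
- by move=> x; rewrite !hcomp1l vc1l // src_Fu.
Defined.

End Object.
End Strictification.
#[local] Hint Resolve inv_path_cell : inv.

(** * Replacing the object values of a functor by isomorphic ones *)

Section Conjugation.
Variables (A B : Category) (T : Functor A B) (o : A -> B).
Variables (c : forall x, hom (o x) (T x)) (c' : forall x, hom (T x) (o x)).
Hypotheses (cc' : forall x, c x · c' x = id1 (o x))
  (c'c : forall x, c' x · c x = id1 (T x)).

(** Used to extend [strictify] to transformations by conjugating precomposition with the projection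
    by [strictify_cmp]; functoriality and full faithfulness then carry over. *)
Definition conj_functor : Functor A B.
Proof.
refine {| fob := o; fmap := fun x y f => c x · fmap T f · c' y |}.
- by move=> x; rewrite fmap_id comp1r.
- by move=> x y z f g; rewrite fmap_comp !compA -(compA (c' y)) c'c comp1l.
Defined.

Lemma conj_functor_fully_faithful :
  fully_faithful T -> fully_faithful conj_functor.
Proof.
have K x y (f : hom (T x) (T y)) : c' x · (c x · f · c' y) · c y = f.
  by rewrite !compA c'c comp1r -compA c'c comp1l.
move=> [faith full]; split=> [x y f g /= e | x y g].
  by apply: faith; rewrite -[LHS]K e K.
have [f ef] := full x y (c' x · g · c y); exists f.
by rewrite /= ef !compA cc' comp1r -compA cc' comp1l.
Qed.
End Conjugation.

(** The projection is the identity on objects and surjective on 1-cells, which gives faithfulness.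
    For fullness, the 2-cell components have to depend only on classes, and are then read off on
    representatives. *)
Lemma precomp_cong_proj_fully_faithful (X : Category)
  (R : forall x y : X, hom x y -> hom x y -> Prop) (D : TwoCat) :
  fully_faithful (precomp (D := D) (cong_proj R)).
Proof.
split=> [F G al be e | F G g].
  apply: psnat_ext => [x | x y u].
    exact: (f_equal (fun a : PsNat (ps_pre (cong_proj R) F)
    (ps_pre (cong_proj R) G) =>
    N1 a (x : cong_twocat R)) e).
  rewrite -(reprK u).
  exact: (f_equal (fun a : PsNat (ps_pre (cong_proj R) F)
    (ps_pre (cong_proj R) G) =>
    N2 a (repr u : @hom (cong_twocat R) x y)) e).
(* Naturality of [g] at the cell from [u] to [v], whose images under both functors are
   identities. *)
have g_cls (x y : X) (u v : @hom (cong_twocat R) x y) :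
    quot_map R u = quot_map R v -> N2 g u = N2 g v.
  move=> e; have [r _] := cls_eq (cong1_equiv R x y) u v.
  have := nat_N2 g (CongCell (r e) : @cell (cong_twocat R) x y).
  have /= -> := @F2_id2 _ _ F x y (quot_map R u).
  have /= -> := @F2_id2 _ _ G x y (quot_map R u).
  rewrite !hcomp_id2.
  rewrite vc1l; [by rewrite (src_N2 g) /= e|].
  by rewrite vc1r; [by rewrite (tgt_N2 g)|].
unshelve eexists (@Build_PsNat _ _ F G (N1 g)
  (fun x y u => N2 g (repr u : @hom (cong_twocat R) x y)) _ _ _ _ _ _).
- by move=> x y u; rewrite (src_N2 g) /= /quot_map reprK.
- by move=> x y u; rewrite (tgt_N2 g) /= /quot_map reprK.
- by move=> x y u; apply: (inv_N2 g).
- move=> x y a.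
  have /= -> := @F2_id2 _ _ F x y a; have /= -> := @F2_id2 _ _ G x y a.
  rewrite !hcomp_id2.
  by rewrite vc1l ?vc1r // ?(src_N2 g) ?(tgt_N2 g) /= /quot_map reprK.
- move=> x y z u v.
  have -> : N2 g (repr (u · v))
          = N2 g (repr u · repr v : @hom (cong_twocat R) x z).
    by apply: g_cls; rewrite quot_map_comp /quot_map !reprK.
  by have := N2_comp g (repr u) (repr v); rewrite /= /quot_map !reprK.
- move=> x.
  have -> : N2 g (repr (id1 x)) = N2 g (@id1 (cong_twocat R) x).
    by apply: g_cls; rewrite /quot_map reprK.
  exact: (N2_id g).
- apply: psnat_ext => //= x y u; apply: g_cls; by rewrite /quot_map reprK.
Qed.

Lemma comp2F1l (A B : TwoCat) (K : TwoFunctor A B) : comp2F (id2F A) K = K.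
Proof.
case: K => K sK.
apply: two_functor_ext => /=;
  [exact: eq_refl | exact: JMeq_refl | exact: JMeq_refl].
Qed.

(** Postcompose the isomorphism [cong_proj_cong_section] with [K]. *)
Lemma precomp_cong_proj_post_cong_section (X : Category)
  (R : forall x y : X, hom x y -> hom x y -> Prop) (D : TwoCat)
  (K : TwoFunctor (cong_twocat R) D) :
  iso_ob (A := TwoRep (cong_twocat R) D)
    (precomp (cong_proj R) (ps_post (cong_section R) K)) (proj1_sig K).
Proof.
have := fmap_iso (post_TwoRep _ K) (cong_proj_cong_section R).
have -> : post_TwoRep _ K (proj1_sig (id2F (cong_twocat R))) = proj1_sig K.
  exact: (f_equal (@proj1_sig _ _) (comp2F1l K)).
have /= <- // := f_equal (fun T : Functor
    (TwoRep (locally_discrete (quot_cat R)) (cong_twocat R))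
    (TwoRep (cong_twocat R) D) => T (cong_section R))
  (precomp_post (cong_proj R) K).
Qed.

(** * Strictification as a functor, natural in the target *)

Section Strictify.
Variables (V : Type) (E : V -> V -> Type).
Let X := free_cat E.
Variable R : forall x y : X, hom x y -> hom x y -> Prop.
Let Q := locally_discrete (quot_cat R).

Lemma strictify_cmp1 (D : TwoCat) (F : PsFunctor Q D) (x : cong_twocat R) :
  N1 (strictify_cmp F) x · id1 (F x) = id1 (F x).
Proof. exact: comp1l. Qed.

Definition strictify_cmp_inv (D : TwoCat) (F : PsFunctor Q D) :=
  psnat_inv (strictify_cmp1 F) (strictify_cmp1 F).

Definition strictify_functor (D : TwoCat) :
  Functor (TwoRep Q D) (TwoRep (cong_twocat R) D) :=
  @conj_functor _ _ (precomp (cong_proj R)) (fun F => proj1_sig (strictify F))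
    (@strictify_cmp V E R D) (@strictify_cmp_inv D)
    (fun F => proj1 (psnat_iso (strictify_cmp1 F) (strictify_cmp1 F)))
    (fun F => proj2 (psnat_iso (strictify_cmp1 F) (strictify_cmp1 F))).

Lemma strictify_fully_faithful (D : TwoCat) :
  fully_faithful (strictify_functor D).
Proof.
apply: conj_functor_fully_faithful; exact: precomp_cong_proj_fully_faithful.
Qed.

Lemma strictify_iso_pre (D : TwoCat) (F : PsFunctor Q D) :
  iso_ob (A := TwoRep (cong_twocat R) D) (strictify_functor D F)
    (precomp (cong_proj R) F).
Proof.
exists (strictify_cmp F), (strictify_cmp_inv F).
exact: (psnat_iso (strictify_cmp1 F) (strictify_cmp1 F)).
Qed.

Lemma strictify_post_cong_section (D : TwoCat)
  (K : TwoFunctor (cong_twocat R) D) :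
  iso_ob (A := TwoRep (cong_twocat R) D)
    (strictify_functor D (ps_post (cong_section R) K)) (proj1_sig K).
Proof.
apply: iso_ob_trans (strictify_iso_pre _) _.
exact: precomp_cong_proj_post_cong_section.
Qed.

Lemma path_map_post (D D' : TwoCat) (K : TwoFunctor D D') (F : PsFunctor Q D)
  (x y : V) (p : path E x y) :
  F1 (proj1_sig K) (path_map F p) = path_map (ps_post F K : PsFunctor Q D') p.
Proof.
case: K => K sK; elim: p => [w | {}x w {}y e p IH] /=.
  exact: strict_id.
by rewrite strict_comp // IH.
Qed.

Lemma path_cell_post (D D' : TwoCat) (K : TwoFunctor D D') (F : PsFunctor Q D)
  (x y : V) (p : path E x y) :
  F2 (proj1_sig K) (path_cell F p)
  = path_cell (ps_post F K : PsFunctor Q D') p.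
Proof.
case: K => K sK; elim: p => [w | {}x w {}y e p IH] //=.
rewrite F2_vc; first by bnd; rewrite tgt_path_cell.
by rewrite strict_hcomp // F2_id2 IH.
Qed.

(** This is an equality because [K] is strict and preserves the chosen inverses, inverses being
    unique. *)
Lemma strictify_post (D D' : TwoCat) (K : TwoFunctor D D')
  (F : PsFunctor Q D) :
  ps_post (proj1_sig (strictify F)) K
  = proj1_sig (strictify (ps_post F K : PsFunctor Q D')).
Proof.
apply: psfunctor_ext => //=; apply: eq_JMeq;
  do ?(apply: functional_extensionality_dep => ?).
- exact: path_map_post.
- rewrite F2_vc ?F2_vinv ?path_cell_post //; auto with inv.
  by rewrite src_vinv ?path_cell_tgt; auto with inv.
- case: K => K sK; rewrite F2_id2 strict_comp //.
  by rewrite !(path_map_post (exist _ K sK)).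
- by case: K => K sK; rewrite F2_id2 strict_id.
Qed.

Lemma strictify_functor_natural (D D' : TwoCat) (K : TwoFunctor D D') :
  compF (strictify_functor D) (post_TwoRep _ K)
  = compF (post_TwoRep _ K) (strictify_functor D').
Proof.
apply: functor_ext => [F | F G al]; first exact: strictify_post.
apply: psnat_JMeq; try exact: strictify_post; last first.
  move=> x y u /=; apply: eq_JMeq; case: K => K sK /=.
  have iG := inv_path_cell G u.
  have e1 : tgt (path_cell F u ⋆₀ id2 (N1 al y))
          = src (N2 al (quot_map R u)).
    by rewrite tgt_hcomp tgt_path_cell tgt_id2 (src_N2 al).
  have e2 : tgt (path_cell F u ⋆₀ id2 (N1 al y) ⋆₁ N2 al (quot_map R u))
          = src (id2 (N1 al x) ⋆₀ vinv (path_cell G u)).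
    rewrite tgt_vc // src_hcomp src_vinv // tgt_path_cell src_id2.
    exact: (tgt_N2 al).
  rewrite -!(path_cell_post (exist _ K sK)) -!F2_vinv //.
  rewrite !hcomp1l !hcomp1r !comp1l /= !(F2_vc K) //.
  by rewrite !(strict_hcomp sK) !(F2_id2 K).
move=> x /=; apply: eq_JMeq; case: K => K sK /=.
by rewrite !strict_comp // !strict_id.
Qed.
End Strictify.

(** * The equivalence *)

(** For essential surjectivity of [strict_functor_of_rep], whose outer factors will be isomorphisms
    of categories. *)
Lemma iso_ob_comp3 (A B C D : Category) (F : Functor A B) (F' : Functor B A)
  (G : Functor B C) (H : Functor C D) (H' : Functor D C) (x : B) (y : D) :
  compF F' F = idF B -> compF H' H = idF D -> iso_ob (G x) (H' y) ->
  iso_ob (compF (compF F G) H (F' x)) y.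
Proof.
move=> F'F H'H /(fmap_iso H).
have -> : H (H' y) = y by exact: (f_equal (fun T : Functor D D => T y) H'H).
by have /= -> := f_equal (fun T : Functor B B => T x) F'F.
Qed.

Definition restrict (A B : Category) (P : A -> Prop) (Q : B -> Prop)
  (T : Functor A B) (h : forall x, P x -> Q (T x)) :
  Functor (full_subcategory P) (full_subcategory Q).
Proof.
refine (@Build_Functor (full_subcategory P) (full_subcategory Q)
  (fun x => exist _ (T (proj1_sig x)) (h _ (proj2_sig x)))
  (fun x y f => fmap T f) _ _).
- by move=> x; apply: fmap_id.
- by move=> x y z f g; apply: fmap_comp.
Defined.

Lemma corestrict_restrict (A B C : Category) (P : B -> Prop) (Q : C -> Prop)
  (F : Functor A B) (h : forall x, P (F x)) (T : Functor B C)
  (hT : forall x, P x -> Q (T x)) :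
  compF (corestrict h) (restrict hT)
  = corestrict (F := compF F T) (fun x => hT _ (h x)).
Proof. exact: functor_ext. Qed.

Lemma comp_corestrict (A B C : Category) (P : C -> Prop) (T : Functor A B)
  (F : Functor B C) (h : forall x, P (F x)) :
  compF T (corestrict h) = corestrict (F := compF T F) (fun x => h (T x)).
Proof. exact: functor_ext. Qed.

(** This form reduces naturality between the full subcategories to an equality of functors into
    [TwoRep]. *)
Lemma post_TwoCatFun_restrict (A B D : TwoCat) (K : TwoFunctor B D) :
  post_TwoCatFun A K
  = restrict (A := TwoRep A B) (B := TwoRep A D) (T := post_TwoRep A K)
    (P := @strict A B) (Q := @strict A D) (fun F sF => strict_post K sF).
Proof. exact: functor_ext. Qed.

Definition thin (A : TwoCat) : Prop :=
  forall (x y : A) (a b : cell x y), parallel a b -> a = b.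

Lemma vc_cancel_l (A : TwoCat) (x y : A) (p a b : cell x y) :
  invertible p -> tgt p = src a -> tgt p = src b -> p ⋆₁ a = p ⋆₁ b -> a = b.
Proof.
move=> ip ea eb e.
rewrite -(vc1l ea) -(vc1l eb) -(vc_vinvl ip) !vcA ?src_vinv ?tgt_vinv // e //.
Qed.

(** The composite of [P] and [K] identifies parallel cells because [B] is thin. Naturality of the
    isomorphism transfers this to the cells themselves, whiskered by its 1-cell component. *)
Lemma thin_retract (A B : TwoCat) (P : TwoFunctor A B) (K : TwoFunctor B A) :
  thin B ->
  iso_ob (A := TwoCatFun A A) (post_TwoCatFun A K P) (id2F A) ->
  thin A.
Proof.
move=> thinB [al [be [_ be_al]]] x y a b [es et].
have e : F2 (proj1_sig (comp2F P K)) a = F2 (proj1_sig (comp2F P K)) b.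
  by rewrite /= (thinB _ _ (F2 (proj1_sig P) a) (F2 (proj1_sig P) b)) //;
    split; rewrite ?src_F2 ?tgt_F2 ?es ?et.
have {}e : id2 (N1 al x) ⋆₀ a = id2 (N1 al x) ⋆₀ b.
  apply: (vc_cancel_l (p := N2 al (src a))); [exact: inv_N2 |
    by rewrite tgt_N2 src_hcomp src_id2 |
    by rewrite tgt_N2 src_hcomp src_id2 es |].
  have := nat_N2 al a; have := nat_N2 al b.
  by rewrite e es et /= => -> ->.
(* Inverse transformations have strictly inverse 1-cell components, so the whiskering can be
   undone. *)
have unit : N1 be x · N1 al x = id1 x.
  exact: (f_equal (fun c : PsNat (proj1_sig (id2F A)) (proj1_sig (id2F A)) =>
    N1 c x) be_al).
by rewrite -(hcomp_sectionK a unit) e hcomp_sectionK.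
Qed.

(** * The presented 2-category and the codiscrete one *)

Section Presented.
Variable S : Polygraph31.
Let X := free_cat (@S1 S).
(** The relation defining [presented_category S], which is thus convertible to [quot_cat rel2]. *)
Definition rel2 (x y : free_cat (@S1 S)) (u v : hom x y) : Prop :=
  inhabited (S2 u v).

(** Terms are derivations of the congruence kept as data: the constructors of [term] and [cong1]
    correspond one to one. *)
Lemma term_cong (x y : X) (u v : hom x y) : term u v -> cong1 rel2 u v.
Proof.
elim=> {x y u v}.
- by move=> x y u v s; apply: cong1_gen; constructor.
- by move=> *; apply: cong1_refl.
- by move=> x y u v w _ h _; apply: cong1_trans.
- by move=> x y z u v u' v' _ h _ h'; apply: cong1_comp.
- by move=> x y u v _; apply: cong1_sym.
Qed.

Lemma cong_term (x y : X) (u v : hom x y) :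
  cong1 rel2 u v -> inhabited (term u v).
Proof.
elim=> {x y u v}.
- by move=> x y u v [s]; constructor; apply: t_gen.
- by move=> x y u; constructor; apply: t_id.
- by move=> x y u v _ [t]; constructor; apply: t_inv.
- by move=> x y u v w _ [t] _ [t']; constructor; apply: t_vcomp t t'.
- by move=> x y z u u' v v' _ [t] _ [t']; constructor; apply: t_hcomp.
Qed.

Lemma cell_cong (x y : presented_21 S) (a : cell x y) :
  cong1 rel2 (src a) (tgt a).
Proof. exact: term_cong (bbody (repr (repr a))). Qed.

Lemma cong_cell_lift (x y : X) (u v : hom x y) : cong1 rel2 u v ->
  exists a : @cell (presented_21 S) x y, src a = u /\ tgt a = v.
Proof.
move=> /cong_term [t].
exists (quot_cell (@rel3_parallel S) (cls (@beq S x y) (BTerm t))).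
split.
  exact: eq_trans (src_repr (@rel3_parallel S) _) (bsrc_repr _).
exact: eq_trans (tgt_repr (@rel3_parallel S) _) (btgt_repr _).
Qed.

(** Every cell of the quotient is the class of a free cell with the same boundary. *)
Lemma homotopy_basis_thin : homotopy_basis S <-> thin (presented_21 S).
Proof.
split=> [hb x y a b par | th x y a b [es et]].
  by rewrite -[a]reprK -[b]reprK; apply: hb.
apply: th; split.
  exact: eq_trans (src_repr (@rel3_parallel S) a)
    (eq_trans es (eq_sym (src_repr (@rel3_parallel S) b))).
exact: eq_trans (tgt_repr (@rel3_parallel S) a)
  (eq_trans et (eq_sym (tgt_repr (@rel3_parallel S) b))).
Qed.

Definition to_cong_twocat : TwoFunctor (presented_21 S) (cong_twocat rel2).
Proof.
refine (@strict_2functor (presented_21 S) (cong_twocat rel2)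
  (fun x => x) (fun x y u => u)
  (fun x y a => CongCell (cell_cong a)) _ _ _ _ _ _ _) => //.
- by move=> x y u; apply: cong_twocat_ext;
    [exact: (@src_id2 (presented_21 S)) | exact: (@tgt_id2 (presented_21 S))].
- move=> x y a b e; apply: cong_twocat_ext.
    by rewrite src_vc_cong_twocat //=; apply: (@src_vc (presented_21 S)).
  by rewrite tgt_vc_cong_twocat //=; apply: (@tgt_vc (presented_21 S)).
- by move=> x y z a b; apply: cong_twocat_ext;
    [exact: (@src_hcomp (presented_21 S))
    | exact: (@tgt_hcomp (presented_21 S))].
Defined.

(** An arbitrary choice; once [presented_21 S] is thin, its boundary alone makes it functorial. *)
Definition cell_lift (x y : X) (a : cong_cell rel2 x y) :
  @cell (presented_21 S) x y :=
  proj1_sig (constructive_indefinite_description _ (cong_cell_lift (ccong a))).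

Lemma src_cell_lift (x y : X) (a : cong_cell rel2 x y) :
  src (cell_lift a) = csrc a.
Proof.
by rewrite /cell_lift; case: (constructive_indefinite_description _ _) => ? [].
Qed.

Lemma tgt_cell_lift (x y : X) (a : cong_cell rel2 x y) :
  tgt (cell_lift a) = ctgt a.
Proof.
by rewrite /cell_lift; case: (constructive_indefinite_description _ _) => ? [].
Qed.

Definition of_cong_twocat (th : thin (presented_21 S)) :
  TwoFunctor (cong_twocat rel2) (presented_21 S).
Proof.
refine (@strict_2functor (cong_twocat rel2) (presented_21 S)
  (fun x => x) (fun x y u => u)
  cell_lift _ _ _ _ _ _ _) => //.
- by move=> x y a; apply: src_cell_lift.
- by move=> x y a; apply: tgt_cell_lift.
- move=> x y u; apply: th; split.
    by rewrite src_cell_lift (@src_id2 (presented_21 S)).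
  by rewrite tgt_cell_lift (@tgt_id2 (presented_21 S)).
- move=> x y a b e.
  have e' : tgt (cell_lift a) = src (cell_lift b).
    by rewrite src_cell_lift tgt_cell_lift.
  apply: th; split.
    by rewrite (@src_vc (presented_21 S)) // !src_cell_lift csrc_vc_cong_twocat.
  by rewrite (@tgt_vc (presented_21 S)) // !tgt_cell_lift ctgt_vc_cong_twocat.
- move=> x y z a b; apply: th; split.
    by rewrite (@src_hcomp (presented_21 S)) !src_cell_lift.
  by rewrite (@tgt_hcomp (presented_21 S)) !tgt_cell_lift.
Defined.

Lemma to_of_cong_twocat (th : thin (presented_21 S)) :
  comp2F to_cong_twocat (of_cong_twocat th) = id2F (presented_21 S).
Proof.
apply: two_functor_ext => /=; [exact: eq_refl | exact: JMeq_refl |].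
refine (@eq_JMeq (forall x y : presented_21 S, cell x y -> cell x y)
  (fun x y a => cell_lift (CongCell (cell_cong a))) (fun x y a => a) _).
do 3!(apply: functional_extensionality_dep => ?).
by apply: th; split; [exact: src_cell_lift | exact: tgt_cell_lift].
Qed.

Lemma of_to_cong_twocat (th : thin (presented_21 S)) :
  comp2F (of_cong_twocat th) to_cong_twocat = id2F (cong_twocat rel2).
Proof.
apply: two_functor_ext => /=; [exact: eq_refl | exact: JMeq_refl |].
refine (@eq_JMeq (forall x y : cong_twocat rel2, cell x y -> cell x y)
  (fun x y a => CongCell (cell_cong (cell_lift a))) (fun x y a => a) _).
do 3!(apply: functional_extensionality_dep => ?).
by apply: cong_twocat_ext; [exact: src_cell_lift | exact: tgt_cell_lift].
Qed.

(** * The two implications, for a fixed isomorphism with the presented category *)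

Variables (C : Category) (F : Functor (presented_category S) C)
  (G : Functor C (presented_category S)).
Hypotheses (FG : compF F G = idF _) (GF : compF G F = idF _).

Lemma precomp_discrete_inverse (D : TwoCat) :
  compF (precomp (discrete_functor F)) (precomp (discrete_functor G))
    = idF (TwoRep (locally_discrete C) D) /\
  compF (precomp (discrete_functor G)) (precomp (discrete_functor F))
    = idF (TwoRep (locally_discrete (presented_category S)) D).
Proof.
by apply: precomp_inverse; rewrite discrete_functor_comp ?FG ?GF
  discrete_functor_id.
Qed.

Definition strict_functor_of_rep (D : TwoCat) :
  Functor (TwoRep (locally_discrete C) D) (TwoRep (presented_21 S) D) :=
  compF (compF (precomp (discrete_functor F)) (strictify_functor rel2 D))
    (precomp to_cong_twocat).

Lemma strict_strict_functor_of_rep (D : TwoCat)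
  (M : PsFunctor (locally_discrete C) D) : strict (strict_functor_of_rep D M).
Proof. apply: strict_pre; exact: (proj2_sig (strictify _)). Qed.

Lemma strict_functor_of_rep_natural (D E : TwoCat) (K : TwoFunctor D E) :
  compF (strict_functor_of_rep D) (post_TwoRep _ K)
  = compF (post_TwoRep _ K) (strict_functor_of_rep E).
Proof.
rewrite /strict_functor_of_rep !compFA precomp_post.
rewrite -(compFA (strictify_functor rel2 D)) strictify_functor_natural.
transitivity (compF (compF (precomp (discrete_functor F)) (post_TwoRep _ K))
    (compF (strictify_functor rel2 E) (precomp to_cong_twocat))).
  by rewrite !compFA.
by rewrite precomp_post !compFA.
Qed.

Lemma coherent_equivalence : thin (presented_21 S) ->
  exists Phi : forall D : TwoCat,
      Functor (TwoRep (locally_discrete C) D) (TwoCatFun (presented_21 S) D),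
    (forall D : TwoCat, is_equivalence (Phi D)) /\
    (forall (D E : TwoCat) (K : TwoFunctor D E),
       compF (Phi D) (post_TwoCatFun (presented_21 S) K)
       = compF (post_TwoRep (locally_discrete C) K) (Phi E)).
Proof.
move=> th; exists (fun D => corestrict (B := TwoRep (presented_21 S) D)
  (P := @strict (presented_21 S) D) (F := strict_functor_of_rep D)
  (@strict_strict_functor_of_rep D)).
split=> [D | D E K].
  have [FGid GFid] := precomp_discrete_inverse D.
  have [JI IJ] := precomp_inverse D (to_of_cong_twocat th) (of_to_cong_twocat th).
  apply: corestrict_equivalence => [|y sy].
    apply: fully_faithful_comp; last exact: inverse_fully_faithful IJ JI.
    apply: fully_faithful_comp; first exact: inverse_fully_faithful FGid GFid.
    exact: strictify_fully_faithful.
  (* The preimage of [y]: transport [y] to [cong_twocat rel2], restrict it along the section, and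
     transport the result to [C]. *)
  pose K : TwoFunctor (cong_twocat rel2) D :=
    exist _ (ps_pre (of_cong_twocat th) y) (strict_pre _ sy).
  exists (precomp (discrete_functor G) (ps_post (cong_section rel2) K)).
  apply: (iso_ob_comp3 GFid JI); exact: strictify_post_cong_section K.
rewrite post_TwoCatFun_restrict corestrict_restrict comp_corestrict.
exact: corestrict_eq (strict_functor_of_rep_natural K).
Qed.

Lemma equivalence_thin (Phi : forall D : TwoCat,
    Functor (TwoRep (locally_discrete C) D) (TwoCatFun (presented_21 S) D)) :
  (forall D : TwoCat, is_equivalence (Phi D)) ->
  (forall (D E : TwoCat) (K : TwoFunctor D E),
     compF (Phi D) (post_TwoCatFun (presented_21 S) K)
     = compF (post_TwoRep (locally_discrete C) K) (Phi E)) ->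
  thin (presented_21 S).
Proof.
move=> eqv nat.
have [M isoM] := is_equivalence_iso_ob
  (B := TwoCatFun (presented_21 S) (presented_21 S)) (id2F _) (eqv _).
have [FGid GFid] := precomp_discrete_inverse (presented_21 S).
pose N := precomp (discrete_functor F) M.
pose K := strictify (N : PsFunctor (locally_discrete (quot_cat rel2)) _).
pose eta := ps_pre (discrete_functor G) (cong_section rel2).
(* By full faithfulness it is enough to compare after precomposition with the projection, where both
   sides are isomorphic to [K]. *)
have isoN : iso_ob N (ps_post (cong_section rel2) K).
  apply: fully_faithful_reflects_iso (precomp_cong_proj_fully_faithful rel2 _) _.
  apply: iso_ob_trans (iso_ob_sym (strictify_iso_pre _)) _.
  exact: iso_ob_sym (precomp_cong_proj_post_cong_section K).
have {}isoN : iso_ob M (post_TwoRep _ K eta).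
  have := fmap_iso (precomp (discrete_functor G)) isoN.
  have /= -> := f_equal (fun T : Functor (TwoRep (locally_discrete C)
    (presented_21 S)) _ => T M) FGid.
  by have /= <- := f_equal (fun T : Functor (TwoRep (locally_discrete
    (presented_category S)) (cong_twocat rel2)) _ => T (cong_section rel2))
    (precomp_post (discrete_functor G) K).
(* The identity is isomorphic to the image under [Phi] of [eta] followed by [K], which naturality
   rewrites as [Phi _ eta] followed by [K]: a factorization through the thin [cong_twocat rel2]. *)
have := iso_ob_trans (iso_ob_sym isoM) (fmap_iso (Phi _) isoN).
have /= <- := f_equal (fun T : Functor (TwoRep (locally_discrete C)
  (cong_twocat rel2)) _ => T eta) (nat _ _ K).
move=> /iso_ob_sym.
apply: (@thin_retract _ (cong_twocat rel2) (Phi _ eta) K).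
by move=> x y a b [es et]; apply: cong_twocat_ext.
Qed.
End Presented.

Theorem theorem5p1p6 (C : Category) (S : Polygraph31)
  (hS : extended_presentation S C) :
  coherent_presentation S C <->
  exists Phi : forall D : TwoCat,
      Functor (TwoRep (locally_discrete C) D) (TwoCatFun (presented_21 S) D),
    (forall D : TwoCat, is_equivalence (Phi D)) /\
    (forall (D E : TwoCat) (K : TwoFunctor D E),
       compF (Phi D) (post_TwoCatFun (presented_21 S) K)
       = compF (post_TwoRep (locally_discrete C) K) (Phi E)).
Proof.
have [F [G [FG GF]]] := hS.
split=> [[_ /homotopy_basis_thin] | [Phi [eqv nat]]].
  exact: coherent_equivalence FG GF.
split=> //; apply/homotopy_basis_thin; exact: equivalence_thin FG GF _ eqv nat.
Qed.
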